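(* Let $T \subseteq 2^{<\omega}$ be a computable tree with $\mu([T]) > 0$ and let $\epsilon > 0$. Then there is a low perfect tree $P \subseteq T$ with $\mu([P]) > \mu([T]) - \epsilon$.
   Context: A (binary) tree is a subset of $2^{<\omega}$ closed under initial segments. $[T]$ denotes the set of all infinite paths through $T$ in Cantor space $2^\omega$, and $\mu$ is the uniform (Lebesgue) measure on $2^\omega$. A tree $P$ is perfect if it is nonempty and equals $\{\sigma \in 2^{<\omega} : \sigma \text{ is an initial segment of some } X \in C\}$ for a nonempty perfect (closed, without isolated points) set $C \subseteq 2^\omega$ (equivalently, every node of $P$ has two incomparable extensions in $P$). A set $P$ is low if its Turing jump satisfies $P' \equiv_T \emptyset'$. *)

(* Defs.v *)
From Stdlib Require Cantor.
From HB Require Import structures.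
From mathcomp Require Import all_boot all_order all_algebra archimedean.
From mathcomp Require Import all_classical all_reals all_analysis.
From mathcomp Require Import measurable_realfun zify lra.

Set Implicit Arguments.
Unset Strict Implicit.
Unset Printing Implicit Defensive.

Import Order.TTheory GRing.Theory Num.Theory.
Import numFieldNormedType.Exports.

Local Open Scope classical_set_scope.

Definition npair (x y : nat) : nat := Cantor.to_nat (x, y).
Definition nfst (z : nat) : nat := (Cantor.of_nat z).1.
Definition nsnd (z : nat) : nat := (Cantor.of_nat z).2.

(* Kleene's partial recursive functions relative to an oracle, as unary
   functions on nat; several arguments are packed with Cantor's pairing. *)
Inductive code : Type :=
| cZero | cSucc | cFst | cSnd | cOracle
| cPair of code & code
| cComp of code & code
| cPrec of code & code
| cMu of code.

(* [eval A c x y]: the function coded by c, run with oracle A on input x,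
   halts with output y.  Primitive recursion [cPrec f g] is the h with
   h(a, 0) = f(a) and h(a, n + 1) = g(a, (n, h(a, n))); [cMu f] maps x to the
   least y with f(x, y) = 0, f(x, m) being defined for all m < y. *)
Fixpoint eval (A : set nat) (c : code) (x y : nat) {struct c} : Prop :=
  match c with
  | cZero => y = 0%N
  | cSucc => y = x.+1
  | cFst => y = nfst x
  | cSnd => y = nsnd x
  | cOracle => y = (x \in A) :> nat
  | cPair f g => exists u v, [/\ eval A f x u, eval A g x v & y = npair u v]
  | cComp f g => exists2 u, eval A g x u & eval A f u y
  | cPrec f g =>
      (fix rec (n r : nat) {struct n} : Prop :=
         match n with
         | 0 => eval A f (nfst x) r
         | m.+1 => exists2 s, rec m s
                     & eval A g (npair (nfst x) (npair m s)) r
         end) (nsnd x) y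
  | cMu f => eval A f (npair x y) 0 /\
             forall m, (m < y)%N -> exists v, eval A f (npair x m) v.+1
  end.

Fixpoint godel (c : code) : nat :=
  match c with
  | cZero => npair 0 0
  | cSucc => npair 1 0
  | cFst => npair 2 0
  | cSnd => npair 3 0
  | cOracle => npair 4 0
  | cPair f g => npair 5 (npair (godel f) (godel g))
  | cComp f g => npair 6 (npair (godel f) (godel g))
  | cPrec f g => npair 7 (npair (godel f) (godel g))
  | cMu f => npair 8 (godel f)
  end.

Lemma npair_inj x y x' y' : npair x y = npair x' y' -> x = x' /\ y = y'.
Proof. by move/Cantor.to_nat_inj => -[-> ->]. Qed.

Lemma godel_inj : injective godel.
Proof.
elim=> [|||||f IHf g IHg|f IHf g IHg|f IHf g IHg|f IHf];
  case=> [|||||f' g'|f' g'|f' g'|f'] //= /npair_inj[] //.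
- by move=> _ /npair_inj[/IHf -> /IHg ->].
- by move=> _ /npair_inj[/IHf -> /IHg ->].
- by move=> _ /npair_inj[/IHf -> /IHg ->].
- by move=> _ /IHf ->.
Qed.

Definition turing_le (B A : set nat) : Prop :=
  exists c : code, forall x, eval A c x (x \in B).

Definition turing_equiv (A B : set nat) : Prop :=
  turing_le A B /\ turing_le B A.

Definition computable (A : set nat) : Prop := turing_le A set0.

Definition jump (A : set nat) : set nat :=
  [set godel c | c in [set c | exists y, eval A c (godel c) y]].

Definition low (A : set nat) : Prop := turing_equiv (jump A) (jump set0).

(* bijective base 2, the first bit being the least significant one *)
Fixpoint string_code (s : seq bool) : nat :=
  if s is b :: s' then ((string_code s').*2 + b).+1 else 0.

Lemma string_code_inj : injective string_code.
Proof.
elim=> [|b s IH] [|b' s'] //= [] e.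
have eb : b = b' by move/(congr1 odd): e; rewrite !oddD !odd_double !oddb.
by move: e; rewrite eb => /addIn/double_inj/IH ->.
Qed.

Definition codes (T : set (seq bool)) : set nat := string_code @` T.

Definition is_tree (T : set (seq bool)) : Prop :=
  forall s t, prefix s t -> T t -> T s.

Definition initial_segment (s : seq bool) (X : cantor_space) : Prop :=
  s = mkseq X (size s).

Definition cylinder (s : seq bool) : set cantor_space :=
  [set X | initial_segment s X].

Definition paths (T : set (seq bool)) : set cantor_space :=
  [set X | forall n, T (mkseq X n)].

Definition perfect_tree (P : set (seq bool)) : Prop :=
  P !=set0 /\
  exists C : set cantor_space, [/\ C !=set0, perfect_set C &
    P = [set s | exists2 X, C X & initial_segment s X]].

Definition cantor_borel := g_sigma_algebraType (@open cantor_space).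

Local Open Scope ring_scope.

Lemma nbhs_cylinder (X : cantor_space) (U : set cantor_space) :
  nbhs X U -> exists n, cylinder (mkseq X n) `<=` U.
Proof.
pose F : set_system cantor_space :=
  [set V | exists n, cylinder (mkseq X n) `<=` V].
have mkP n (Y : cantor_space) :
    cylinder (mkseq X n) Y <-> forall i, (i < n)%N -> Y i = X i.
  rewrite /cylinder /= /initial_segment size_mkseq; split=> [e i lin|e].
    by have := congr1 (nth false ^~ i) e; rewrite !nth_mkseq.
  by apply: (@eq_from_nth _ false); rewrite ?size_mkseq// => i lin; rewrite !nth_mkseq// e.
have FF : Filter F.
  split; first by exists 0%N.
    move=> P Q [n nP] [m mQ]; exists (maxn n m) => Y /mkP YX; split.
      by apply/nP/mkP => i ni; apply: YX; rewrite leq_max ni.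
    by apply/mQ/mkP => i ni; apply: YX; rewrite leq_max ni orbT.
  by move=> P Q PQ [n nP]; exists n; apply: subset_trans PQ.
suff : F --> X by apply.
apply/cvg_sup => i A [B] [[C oC <-] CX CA].
exists i.+1 => Y /mkP /(_ i (ltnSn i)) YX; apply: CA.
by rewrite /= /proj YX.
Qed.

Lemma open_cylinder (s : seq bool) : open (cylinder s).
Proof.
rewrite openE => X sX; rewrite /interior /=.
have : \forall Y \near X, forall i : 'I_(size s), (Y : nat -> bool) i = X i.
  have FX : Filter (nbhs X) by exact: nbhs_filter.
  apply: (@filter_forall _ _ (fun (i : 'I_(size s)) (Y : cantor_space) => (Y : nat -> bool) i = X i) _ FX) => i.
  have : open ((@proj nat (fun=> bool) i : cantor_space -> bool) @^-1` [set X i]).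
    apply: open_comp => [? _|]; first exact: proj_continuous.
    exact: discrete_open.
  by rewrite openE => /(_ X erefl).
apply: filterS => Y YX; rewrite /cylinder /= /initial_segment.
apply: (@eq_from_nth _ false); rewrite ?size_mkseq// => i lis.
by rewrite nth_mkseq// (YX (Ordinal lis)) [in LHS]sX nth_mkseq.
Qed.

Lemma cantor_borel_cylinder :
  @measurable _ cantor_borel = <<s range cylinder >>.
Proof.
apply/seteqP; split; last first.
  apply: smallest_sub; first exact: smallest_sigma_algebra.
  by move=> _ [s _ <-]; apply: sub_sigma_algebra; exact: open_cylinder.
apply: smallest_sub; first exact: smallest_sigma_algebra.
move=> U oU.
have -> : U = \bigcup_(s in [set s | cylinder s `<=` U]) cylinder s.
  apply/seteqP; split=> [X UX|X [s /=]]; last exact.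
  have [n nU] := nbhs_cylinder (open_nbhs_nbhs (conj oU UX)).
  by exists (mkseq X n) => //; rewrite /cylinder /= /initial_segment size_mkseq.
rewrite bigcup_mkcond.
apply: (@countable_bigcupT_measurable _ (g_sigma_algebraType (range cylinder))) => //.
move=> s.
by case: ifP => // _; apply: sub_sigma_algebra; exists s.
Qed.

Lemma measurable_paths (T : set (seq bool)) :
  measurable (paths T : set cantor_borel).
Proof.
have -> : paths T =
    \bigcap_n \bigcup_(s in [set s | T s /\ size s = n]) cylinder s.
  apply/seteqP; split => [X TX n _|X h n].
    exists (mkseq X n); first by rewrite /= size_mkseq.
    by rewrite /cylinder /= /initial_segment size_mkseq.
  by have [s [Ts <-] <-] := h n Logic.I.
apply: bigcapT_measurable => n; rewrite bigcup_mkcond.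
apply: countable_bigcupT_measurable => // s; case: ifP => // _.
by apply: sub_sigma_algebra; exact: open_cylinder.
Qed.

Section uniform_measure.
Variable R : realType.

Definition binary_digits (x : R) : cantor_borel :=
  fun n => odd (Num.truncn (x * 2 ^+ n.+1)).

(* the law of the binary digits of a uniformly distributed point of [0, 1[ *)
Definition uniform_measure : set cantor_borel -> \bar R :=
  pushforward
    (mrestr (@lebesgue_measure R) (measurable_itv `[(0 : R), 1[))
    binary_digits.

Local Notation bits := binary_digits.

Lemma measurable_binary_digits : measurable_fun setT bits.
Proof.
refine (@measurability _ _ (measurableTypeR R) cantor_borel setT bits _ cantor_borel_cylinder _) => _ [_ [s _ <-] <-].
rewrite setTI.
have -> : bits @^-1` cylinder s = \bigcap_(i in `I_(size s))
    [set x : R | odd (Num.truncn (x * 2 ^+ i.+1)) = nth false s i].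
  apply/seteqP; split=> [x /= sx i /= lis|x h].
    by rewrite [in RHS]sx nth_mkseq.
  apply: (@eq_from_nth _ false); rewrite ?size_mkseq// => i lis.
  by rewrite nth_mkseq// -h.
apply: bigcap_measurableType => // i _.
have md (b : bool) : measurable [set x : R | odd (Num.truncn x) = b].
  have -> : [set x : R | odd (Num.truncn x) = b] = \bigcup_(k in [set k | odd k = b])
      [set x : R | Num.truncn x = k].
    apply/seteqP; split=> [x /= xb|x [k /= <- ->]//].
    by exists (Num.truncn x).
  apply: bigcup_measurable => k _.
  have -> : [set x : R | Num.truncn x = k] =
      [set` `[k%:R, k.+1%:R[] `|` (if k == 0%N then [set` `]-oo, 0[] else set0).
    apply/seteqP; split => x /=.
      move=> <-; have [x0|x0] := leP 0 x.
        by left; rewrite in_itv/=; exact: truncn_itv.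
      by right; rewrite truncn_floor leNgt x0 /= in_itv.
    rewrite in_itv /= => -[|]; first exact: truncn_def.
    case: eqP => // ->; rewrite /= in_itv /= => x0.
    by rewrite truncn_floor leNgt x0.
  by apply: measurableU => //; case: ifP.
have mf : measurable_fun setT (fun x : R => x * 2 ^+ i.+1) by exact: mulrr_measurable.
by have := mf measurableT _ (md (nth false s i)); rewrite setTI.
Qed.

Let uniform_measure0 : uniform_measure set0 = 0%E.
Proof. by rewrite /uniform_measure /pushforward preimage_set0 measure0. Qed.

Let uniform_measure_ge0 A : (0 <= uniform_measure A)%E.
Proof. by rewrite /uniform_measure /pushforward measure_ge0. Qed.

Let uniform_measure_sigma_additive :
  semi_sigma_additive uniform_measure.
Proof.
have mB A : measurable A -> measurable (bits @^-1` A).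
  by move=> mA; rewrite -[X in measurable X]setTI; exact: measurable_binary_digits.
move=> F mF tF mUF; rewrite /uniform_measure /pushforward preimage_bigcup.
apply: measure_semi_sigma_additive.
- by move=> n; exact: mB.
- apply/trivIsetP => /= i j _ _ ij; rewrite -preimage_setI.
  by move/trivIsetP : tF => /(_ _ _ _ _ ij) ->//; rewrite preimage_set0.
- by rewrite -preimage_bigcup; exact: mB.
Qed.

HB.instance Definition _ := isMeasure.Build _ _ _ uniform_measure
  uniform_measure0 uniform_measure_ge0 uniform_measure_sigma_additive.

Lemma truncn_half (y : R) : 0 <= y -> (Num.truncn (y * 2))./2 = Num.truncn y.
Proof.
move=> y0; apply/esym/truncn_def.
have := @truncn_itv _ (y * 2) (mulr_ge0 y0 (ler0n _ 2)).
move: (Num.truncn (y * 2)) => k /andP[].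
have e : k%:R = (odd k)%:R + 2 * (k./2)%:R :> R.
  by rewrite -{1}(odd_double_half k) natrD -mul2n natrM.
have o0 : 0 <= (odd k)%:R :> R by [].
have o1 : (odd k)%:R <= 1 :> R by rewrite lern1 leq_b1.
by rewrite -!natr1 e => ? ?; apply/andP; split; lra.
Qed.

Let strval (s : seq bool) := foldl (fun n (b : bool) => (n.*2 + b)%N) 0%N s.

Lemma cylinder_binary_digits (x : R) (s : seq bool) : 0 <= x < 1 ->
  cylinder s (bits x) <-> Num.truncn (x * 2 ^+ size s) = strval s.
Proof.
move=> /andP[x0 x1]; elim/last_ind: s => [|s b IH].
  by rewrite expr0 mulr1; split => // _; apply: truncn_def; rewrite x0 x1.
have -> : cylinder (rcons s b) (bits x) <->
    cylinder s (bits x) /\ bits x (size s) = b.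
  rewrite /cylinder /= /initial_segment size_rcons mkseqS; split.
    by move=> /rcons_inj[].
  by move=> [<- ->].
rewrite IH /strval foldl_rcons size_rcons /binary_digits.
rewrite -(truncn_half (mulr_ge0 x0 (exprn_ge0 _ (ler0n _ 2)))) -mulrA -exprSr.
move: (Num.truncn _) => k; split=> [[<- <-]|->].
  by rewrite addnC odd_double_half.
by rewrite addnC half_bit_double oddD odd_double oddb addbF.
Qed.

Lemma uniform_measure_cylinder (s : seq bool) :
  uniform_measure (cylinder s) = (2 ^- size s)%:E.
Proof.
rewrite /uniform_measure /pushforward /mrestr.
have p0 : 0 < 2 ^+ size s :> R by rewrite exprn_gt0.
set v := strval s.
have vlt : (v < 2 ^ size s)%N.
  rewrite /v; elim/last_ind: {v p0} s => // s b.
  rewrite /strval foldl_rcons size_rcons expnS; case: b; lia.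
have -> : bits @^-1` cylinder s `&` [set` `[0, 1[] =
    [set` `[v%:R / 2 ^+ size s, v.+1%:R / 2 ^+ size s[].
  apply/seteqP; split => x /=; rewrite !in_itv /=.
    move=> [+ x01] => /(cylinder_binary_digits _ x01) e.
    have /andP[x0 _] := x01.
    have := truncn_itv (mulr_ge0 x0 (ltW p0)); rewrite e.
    by rewrite ler_pdivrMr// ltr_pdivlMr.
  move=> /andP[vx xv]; have x01 : 0 <= x < 1.
    rewrite (le_trans _ vx) ?divr_ge0// ?(ltW p0)//=.
    by rewrite (lt_le_trans xv)// ler_pdivrMr// mul1r -natrX ler_nat.
  split=> //; apply/cylinder_binary_digits => //; apply: truncn_def.
  by rewrite -ler_pdivrMr// vx /= -ltr_pdivlMr.
rewrite lebesgue_measure_itv /= lte_fin ltr_pM2r ?invr_gt0// ltr_nat ltnSn.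
by rewrite -EFinB -mulrBl -natrB// subSnn mul1r.
Qed.

Let uniform_measure_setT : uniform_measure setT = 1%E.
Proof.
have -> : setT = cylinder [::] :> set cantor_borel by apply/esym/seteqP; split.
by rewrite uniform_measure_cylinder invr1.
Qed.

HB.instance Definition _ := Measure_isProbability.Build _ _ _
  uniform_measure uniform_measure_setT.

End uniform_measure.

(* Main.v *)
From Stdlib Require Cantor.
From mathcomp Require Import all_boot all_order all_algebra archimedean.
From mathcomp Require Import all_classical all_reals all_analysis.
From mathcomp Require Import zify lra.
Require Import Defs.

Set Implicit Arguments.
Unset Strict Implicit.
Unset Printing Implicit Defensive.

Import Order.TTheory GRing.Theory Num.Theory.

Local Open Scope classical_set_scope.

(** Strings of length l correspond to the pairs (l, v) with v < 2 ^ l, and a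
    tree to a function p : nat -> bool on their codes.  The tree P is found
    among the pruned subtrees of T: a subtree p of the first L levels of T is
    pruned when each of its nodes at level l has two different extensions in p
    at level 2l + k + 1 (as far as this level is at most L), and when at each
    level j it contains at least a fraction a / 2^k of all strings of length j.
    An infinite tree all of whose initial parts are pruned is perfect
    (perfect_splitting), and the measure of its paths is at least a / 2^k
    (measure_paths_ge); a and k are chosen with mu [T] - eps < a / 2^k and
    (a + 2) / 2^k <= mu [T].

    Pruned trees of every height L exist (pruned_ex_level).  Give a string of
    length l the weight 4^-l / 2^k.  Among the sets F of strings of length L in
    T, take one that maximizes the measure of the paths through F plus the total
    weight of the strings without an extension in F.  If fewer than two
    extensions of a node survived at its splitting level, the paths through F
    above this node would have a measure below its weight, and deleting them
    would increase the sum.  All weights together amount to less than 2 / 2^k, so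
    at most this much is lost with respect to T.

    Being pruned up to level L is decidable uniformly in L and depends on
    finitely many values of p only, so the pruned trees form a nonempty
    effectively closed class, and the low basis theorem (low_basis) gives a low
    member.  It is proved by forcing with effectively closed classes.
    Numbers e are treated in turn: e is added to a finite set D of programs
    required to diverge if the subclass of those p that make all of D diverge
    remains nonempty.  Emptiness of this subclass is a halting problem by
    compactness, so the jump of the empty set computes all decisions; and the
    e-th program halts with oracle p exactly if e was not added.

    Both the halting of programs within L steps and the reduction to the jump
    require a universal machine for the given programming language.  It is a
    stack machine on numbers (step) whose single steps are primitive recursive
    by inspection, and which runs a program to its result exactly when
    the program halts (eval_reaches, halts_eval). *)

(** * Recursive functions relative to an oracle *)

Lemma nfst_npair x y : nfst (npair x y) = x.
Proof. by rewrite /nfst /npair Cantor.cancel_of_to. Qed.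

Lemma nsnd_npair x y : nsnd (npair x y) = y.
Proof. by rewrite /nsnd /npair Cantor.cancel_of_to. Qed.

Lemma npair_nfst_nsnd z : npair (nfst z) (nsnd z) = z.
Proof.
by rewrite /npair /nfst /nsnd -surjective_pairing Cantor.cancel_to_of.
Qed.

Definition npairE := (nfst_npair, nsnd_npair, npair_nfst_nsnd).

(* From here on pairs are handled only through [npairE]; unfolding Cantor's
   polynomial would make simplification and unification diverge. *)
#[local] Opaque npair nfst nsnd.

Lemma eval_det A c x y z : eval A c x y -> eval A c x z -> y = z.
Proof.
elim: c x y z => [|||||f IHf g IHg|f IHf g IHg|f IHf g IHg|f IHf] x y z /=;
  try by move=> -> ->.
- move=> [u [v [fu gv ->]]] [u' [v' [fu' gv' ->]]].
  by rewrite (IHf _ _ _ fu fu') (IHg _ _ _ gv gv').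
- move=> [u gu fy] [v gv fz]; rewrite (IHg _ _ _ gv gu) in fz.
  exact: IHf fy fz.
- elim: (nsnd x) y z => [|n IHn] y z; first exact: IHf.
  move=> [u nu gy] [v nv gz]; rewrite (IHn _ _ nv nu) in gz.
  exact: IHg gy gz.
- move=> [fy ym] [fz zm]; case: (ltngtP y z) => // [/zm|/ym] [v fv].
    by have := IHf _ _ _ fy fv.
  by have := IHf _ _ _ fz fv.
Qed.

Definition rec_in (O : set nat) (f : nat -> nat) : Prop :=
  exists c, forall x, eval O c x (f x).

(** Runs a program as if its oracle were empty; this turns a computation
    relative to the empty set into one that is the same for all oracles. *)
Fixpoint oracle_free (c : code) : code :=
  match c with
  | cOracle => cZero
  | cPair f g => cPair (oracle_free f) (oracle_free g)
  | cComp f g => cComp (oracle_free f) (oracle_free g)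
  | cPrec f g => cPrec (oracle_free f) (oracle_free g)
  | cMu f => cMu (oracle_free f)
  | _ => c
  end.

Lemma eval_oracle_free A c x y :
  eval A (oracle_free c) x y <-> eval set0 c x y.
Proof.
elim: c x y => [|||||f IHf g IHg|f IHf g IHg|f IHf g IHg|f IHf] x y //=.
- by rewrite in_set0.
- split=> -[u [v [fu gv ->]]]; exists u, v; split=> //;
    by [exact/IHf | exact/IHg].
- by split=> -[u gu fy]; exists u; by [exact/IHg | exact/IHf].
- elim: (nsnd x) y => [|n IHn] y; first exact: IHf.
  by split=> -[s /IHn ns /IHg gs]; exists s.
- by split=> -[/IHf fy h]; split=> // m /h[v /IHf fv]; exists v.
Qed.

Section closure.
Variable O : set nat.
Local Notation rec := (rec_in O).

Lemma rec_id : rec (fun x => x).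
Proof.
exists (cPair cFst cSnd) => x; exists (nfst x), (nsnd x).
by rewrite npair_nfst_nsnd.
Qed.

Lemma rec_comp f g : rec f -> rec g -> rec (fun x => f (g x)).
Proof. by move=> [c cf] [d dg]; exists (cComp c d) => x; exists (g x). Qed.

Lemma rec_pair f g : rec f -> rec g -> rec (fun x => npair (f x) (g x)).
Proof.
by move=> [c cf] [d dg]; exists (cPair c d) => x; exists (f x), (g x).
Qed.

Lemma rec_succ f : rec f -> rec (fun x => (f x).+1).
Proof. by apply: rec_comp; exists cSucc. Qed.

Lemma rec_cst k : rec (fun=> k).
Proof. by elim: k => [|k IH]; [exists cZero | exact: rec_succ]. Qed.

Lemma rec_nfst f : rec f -> rec (fun x => nfst (f x)).
Proof. by apply: rec_comp; exists cFst. Qed.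

Lemma rec_nsnd f : rec f -> rec (fun x => nsnd (f x)).
Proof. by apply: rec_comp; exists cSnd. Qed.

Lemma rec_oracle f : rec f -> rec (fun x => nat_of_bool (f x \in O)).
Proof.
by apply: (@rec_comp (fun x => nat_of_bool (x \in O))); exists cOracle.
Qed.

(** A function of two arguments is called recursive when it is so as a function
    of the pair of its arguments; the closure lemmas for iteration, sums and
    bounded quantifiers below take their functional arguments in this form,
    where the first component carries the values of the outer variables. *)
Lemma rec_comp2 (s : nat -> nat -> nat) f g :
  rec (fun z => s (nfst z) (nsnd z)) -> rec f -> rec g ->
  rec (fun x => s (f x) (g x)).
Proof.
move=> rs rf rg; have := rec_comp rs (rec_pair rf rg).
by congr rec_in; apply/funext => x; rewrite !npairE.
Qed.

Lemma rec_nat_rect b s n :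
  rec b -> rec (fun z => s (nfst z) (nfst (nsnd z)) (nsnd (nsnd z))) -> rec n ->
  rec (fun x => nat_rect (fun=> nat) (b x) (s x) (n x)).
Proof.
move=> [cb hb] [cs hs] rn.
have rp :
    rec (fun z => nat_rect (fun=> nat) (b (nfst z)) (s (nfst z)) (nsnd z)).
  exists (cPrec cb cs) => z /=; elim: (nsnd z) => [|k IH] /=; first exact: hb.
  exists (nat_rect (fun=> nat) (b (nfst z)) (s (nfst z)) k) => //.
  by have := hs (npair (nfst z) (npair k
    (nat_rect (fun=> nat) (b (nfst z)) (s (nfst z)) k))); rewrite !npairE.
have := rec_comp rp (rec_pair rec_id rn).
by congr rec_in; apply/funext => x; rewrite !npairE.
Qed.

End closure.

Ltac recur := repeat first [assumption | apply: rec_id | apply: rec_cst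
  | apply: rec_nfst | apply: rec_nsnd | apply: rec_pair | apply: rec_succ].

Section library.
Variable O : set nat.
Local Notation rec := (rec_in O).

Lemma rec_if (b : nat -> bool) f g :
  rec (fun x => nat_of_bool (b x)) -> rec f -> rec g ->
  rec (fun x => if b x then f x else g x).
Proof.
move=> rb rf rg.
have -> : (fun x => if b x then f x else g x) =
    fun x => nat_rect (fun=> nat) (g x) (fun _ _ => f x) (b x).
  by apply/funext => x; case: (b x).
apply: rec_nat_rect => //.
by apply: (rec_comp rf); recur.
Qed.

Lemma rec_pred f : rec f -> rec (fun x => (f x).-1).
Proof.
move=> rf.
have -> : (fun x => (f x).-1) =
    fun x => nat_rect (fun=> nat) 0%N (fun n _ => n) (f x).
  by apply/funext => x; case: (f x).
by apply: rec_nat_rect; recur.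
Qed.

Lemma rec_add f g : rec f -> rec g -> rec (fun x => (f x + g x)%N).
Proof.
move=> rf rg.
have -> : (fun x => f x + g x)%N =
    fun x => nat_rect (fun=> nat) (f x) (fun _ r => r.+1) (g x).
  by apply/funext => x; elim: (g x) => [|n /= <-]; rewrite (addn0, addnS).
by apply: rec_nat_rect; recur.
Qed.

Lemma rec_sub f g : rec f -> rec g -> rec (fun x => (f x - g x)%N).
Proof.
move=> rf rg.
have -> : (fun x => f x - g x)%N =
    fun x => nat_rect (fun=> nat) (f x) (fun _ r => r.-1) (g x).
  by apply/funext => x; elim: (g x) => [|n /= <-]; rewrite (subn0, subnS).
by apply: rec_nat_rect => //; apply: rec_pred; recur.
Qed.

Lemma rec_mul f g : rec f -> rec g -> rec (fun x => (f x * g x)%N).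
Proof.
move=> rf rg.
have -> : (fun x => f x * g x)%N =
    fun x => nat_rect (fun=> nat) 0%N (fun _ r => r + f x)%N (g x).
  by apply/funext => x; elim: (g x) => [|n /= <-]; rewrite (muln0, mulnSr).
apply: rec_nat_rect => //; first exact: rec_cst.
by apply: rec_add; [|apply: (rec_comp rf)]; recur.
Qed.

Lemma rec_expn k f : rec f -> rec (fun x => (k ^ f x)%N).
Proof.
move=> rf.
have -> : (fun x => k ^ f x)%N =
    fun x => nat_rect (fun=> nat) 1%N (fun _ r => k * r)%N (f x).
  by apply/funext => x; elim: (f x) => [|n /= <-]; rewrite (expn0, expnS).
by apply: rec_nat_rect => //; [|apply: rec_mul]; recur.
Qed.

Lemma rec_negb (b : nat -> bool) : rec (fun x => nat_of_bool (b x)) ->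
  rec (fun x => nat_of_bool (~~ b x)).
Proof.
move=> rb.
have -> : (fun x => nat_of_bool (~~ b x)) = fun x => (1 - b x)%N.
  by apply/funext => x; case: (b x).
by apply: rec_sub; recur.
Qed.

Lemma rec_andb (a b : nat -> bool) : rec (fun x => nat_of_bool (a x)) ->
  rec (fun x => nat_of_bool (b x)) -> rec (fun x => nat_of_bool (a x && b x)).
Proof. by move=> ra rb; under eq_fun do rewrite -mulnb; apply: rec_mul. Qed.

Lemma rec_orb (a b : nat -> bool) : rec (fun x => nat_of_bool (a x)) ->
  rec (fun x => nat_of_bool (b x)) -> rec (fun x => nat_of_bool (a x || b x)).
Proof.
move=> ra rb; under eq_fun do rewrite -[_ || _]negbK negb_or.
by do 2?[apply: rec_negb | apply: rec_andb]; apply: rec_negb.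
Qed.

Lemma rec_implb (a b : nat -> bool) : rec (fun x => nat_of_bool (a x)) ->
  rec (fun x => nat_of_bool (b x)) -> rec (fun x => nat_of_bool (a x ==> b x)).
Proof.
move=> ra rb; under eq_fun do rewrite implybE.
by apply: rec_orb => //; exact: rec_negb.
Qed.

Lemma rec_leq f g : rec f -> rec g -> rec (fun x => nat_of_bool (f x <= g x)%N).
Proof.
move=> rf rg.
have -> : (fun x => nat_of_bool (f x <= g x)%N) = fun x => (1 - (f x - g x))%N.
  by apply/funext => x; rewrite /leq; case: (_ - _)%N.
by apply: rec_sub; [exact: rec_cst | exact: rec_sub].
Qed.

Lemma rec_eqn f g : rec f -> rec g -> rec (fun x => nat_of_bool (f x == g x)).
Proof.
move=> rf rg; under eq_fun do rewrite eqn_leq.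
by apply: rec_andb; apply: rec_leq.
Qed.

Lemma rec_odd f : rec f -> rec (fun x => nat_of_bool (odd (f x))).
Proof.
move=> rf.
have -> : (fun x => nat_of_bool (odd (f x))) =
    fun x => nat_rect (fun=> nat) 0%N (fun _ r => 1 - r)%N (f x).
  apply/funext => x; elim: (f x) => //= n <-; by case: (odd n).
by apply: rec_nat_rect => //; [|apply: rec_sub]; recur.
Qed.

Lemma rec_half f : rec f -> rec (fun x => (f x)./2).
Proof.
move=> rf.
have -> : (fun x => (f x)./2) =
    fun x => nat_rect (fun=> nat) 0%N (fun n r => odd n + r)%N (f x).
  by apply/funext => x; elim: (f x) => //= n <-; rewrite uphalf_half.
by apply: rec_nat_rect => //; [|apply: rec_add; [apply: rec_odd|]]; recur.
Qed.

Lemma rec_modn f g : rec f -> rec g -> rec (fun x => (f x %% g x)%N).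
Proof.
move=> rf rg.
have -> : (fun x => f x %% g x)%N = fun x => nat_rect (fun=> nat) 0%N
    (fun _ r => if r.+1 == g x then 0 else r.+1)%N (f x).
  apply/funext => x; elim: (f x) => [|n /= <-]; first by rewrite mod0n.
  rewrite modnS; congr (if _ then _ else _).
  have [->|g0] := posnP (g x); first by rewrite dvd0n.
  rewrite {1}(divn_eq n (g x)) -addnS dvdn_addr ?dvdn_mull //.
  apply/idP/eqP => [/dvdn_leq|->//]; have := ltn_pmod n g0; lia.
apply: rec_nat_rect => //; first exact: rec_cst.
by apply: rec_if; [apply: rec_eqn; [|apply: (rec_comp rg)]| |]; recur.
Qed.

Lemma rec_iter s b n : rec (fun z => s (nfst z) (nsnd z)) -> rec b -> rec n ->
  rec (fun x => iter (n x) (s x) (b x)).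
Proof.
move=> rs rb rn.
have -> : (fun x => iter (n x) (s x) (b x)) =
    fun x => nat_rect (fun=> nat) (b x) (fun _ r => s x r) (n x).
  by apply/funext => x; elim: (n x) => //= k ->.
apply: rec_nat_rect => //.
by apply: (rec_comp2 rs); recur.
Qed.

Lemma rec_sum (F : nat -> nat -> nat) n :
  rec (fun z => F (nfst z) (nsnd z)) -> rec n ->
  rec (fun x => \sum_(0 <= i < n x) F x i)%N.
Proof.
move=> rF rn.
have -> : (fun x => \sum_(0 <= i < n x) F x i)%N =
    fun x => nat_rect (fun=> nat) 0%N (fun i r => r + F x i)%N (n x).
  apply/funext => x; elim: (n x) => [|k IH]; first by rewrite big_geq.
  by rewrite big_nat_recr //= IH.
apply: rec_nat_rect => //; first exact: rec_cst.
apply: rec_add; first by recur.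
by apply: (rec_comp2 rF); recur.
Qed.

Definition bforall n (p : nat -> bool) : bool := all p (iota 0 n).

Lemma bforallP n (p : nat -> bool) :
  reflect (forall i, (i < n)%N -> p i) (bforall n p).
Proof.
apply: (iffP allP) => h i; last by rewrite mem_iota add0n; exact: h.
by move=> lt_in; apply: h; rewrite mem_iota add0n.
Qed.

Lemma rec_bforall n (p : nat -> nat -> bool) :
  rec (fun z => nat_of_bool (p (nfst z) (nsnd z))) -> rec n ->
  rec (fun x => nat_of_bool (bforall (n x) (p x))).
Proof.
move=> rp rn.
have -> : (fun x => nat_of_bool (bforall (n x) (p x))) =
    fun x => nat_of_bool (\sum_(0 <= i < n x) nat_of_bool (~~ p x i) == 0)%N.
  apply/funext => x; congr nat_of_bool.
  rewrite sum_nat_seq_eq0 /bforall /index_iota subn0.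
  by apply: eq_all => i; case: (p x i).
by apply: rec_eqn; [apply: rec_sum => //; exact: rec_negb | exact: rec_cst].
Qed.

Definition bexists n (p : nat -> bool) : bool := has p (iota 0 n).

Lemma bexistsP n (p : nat -> bool) :
  reflect (exists2 i, (i < n)%N & p i) (bexists n p).
Proof.
apply: (iffP hasP) => -[i].
  by rewrite mem_iota add0n => ? ?; exists i.
by move=> ? ?; exists i; rewrite // mem_iota add0n.
Qed.

Lemma rec_bexists n (p : nat -> nat -> bool) :
  rec (fun z => nat_of_bool (p (nfst z) (nsnd z))) -> rec n ->
  rec (fun x => nat_of_bool (bexists (n x) (p x))).
Proof.
move=> rp rn.
have -> : (fun x => nat_of_bool (bexists (n x) (p x))) =
    fun x => nat_of_bool (~~ bforall (n x) (fun i => ~~ p x i)).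
  by apply/funext => x; rewrite /bforall -has_predC; congr nat_of_bool;
     apply: eq_has => i; rewrite /= negbK.
by apply: rec_negb; apply: rec_bforall => //; exact: rec_negb.
Qed.

End library.

(* Follows the syntax of the function; matching on its head symbol keeps the
   higher-order unification problems trivial. *)
Ltac rec_auto := repeat (
  match goal with H : ?P |- ?P => exact H | _ => idtac end;
  lazymatch goal with
  | |- rec_in _ (fun x => x) => exact: rec_id
  | |- rec_in _ (fun=> ?k) => exact: rec_cst
  | |- rec_in _ (fun x => npair (@?f x) (@?g x)) =>
      refine (@rec_pair _ f g _ _)
  | |- rec_in _ (fun x => nfst (@?f x)) => refine (@rec_nfst _ f _)
  | |- rec_in _ (fun x => nsnd (@?f x)) => refine (@rec_nsnd _ f _)
  | |- rec_in _ (fun x => (@?f x).+1) => refine (@rec_succ _ f _)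
  | |- rec_in _ (fun x => (@?f x).-1) => refine (@rec_pred _ f _)
  | |- rec_in _ (fun x => (@?f x + @?g x)%N) => refine (@rec_add _ f g _ _)
  | |- rec_in _ (fun x => (@?f x - @?g x)%N) => refine (@rec_sub _ f g _ _)
  | |- rec_in _ (fun x => (@?f x * @?g x)%N) => refine (@rec_mul _ f g _ _)
  | |- rec_in _ (fun x => (?k ^ @?f x)%N) => refine (@rec_expn _ k f _)
  | |- rec_in _ (fun x => (@?f x %% @?g x)%N) => refine (@rec_modn _ f g _ _)
  | |- rec_in _ (fun x => (@?f x)./2) => refine (@rec_half _ f _)
  | |- rec_in _ (fun x => nat_of_bool (odd (@?f x))) =>
      refine (@rec_odd _ f _)
  | |- rec_in _ (fun x => nat_of_bool (@?f x == @?g x)) =>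
      refine (@rec_eqn _ f g _ _)
  | |- rec_in _ (fun x => nat_of_bool (@?f x <= @?g x)%N) =>
      refine (@rec_leq _ f g _ _)
  | |- rec_in _ (fun x => nat_of_bool (@?f x && @?g x)) =>
      refine (@rec_andb _ f g _ _)
  | |- rec_in _ (fun x => nat_of_bool (@?f x || @?g x)) =>
      refine (@rec_orb _ f g _ _)
  | |- rec_in _ (fun x => nat_of_bool (@?f x ==> @?g x)) =>
      refine (@rec_implb _ f g _ _)
  | |- rec_in _ (fun x => nat_of_bool (~~ @?f x)) =>
      refine (@rec_negb _ f _)
  | |- rec_in _ (fun x => nat_of_bool (bforall (@?n x) (@?p x))) =>
      refine (@rec_bforall _ n p _ _)
  | |- rec_in _ (fun x => nat_of_bool (bexists (@?n x) (@?p x))) =>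
      refine (@rec_bexists _ n p _ _)
  | |- rec_in _ (fun x => iter (@?n x) (@?f x) (@?b x)) =>
      refine (@rec_iter _ f b n _ _ _)
  | |- rec_in _ (fun _ => match _ with true => _ | false => _ end) =>
      apply: rec_if
  end; cbv beta).

(** * A universal stack machine *)

Definition push i K := (npair i K).+1.

(** One step of the machine on a state [npair v K], where [v] is the current
    value and [K] the stack of the instructions still to be executed.  The tags
    0 to 8 are those of [godel], so that a code is itself the instruction to
    replace [v] by the result of the program on [v].  The other tags are
    continuations: 9 and 10 build a pair, 11 is the loop of a primitive
    recursion, 12 the search of a minimization, and 13 checks that its argument
    is the code of a program, getting stuck if it is not.  An oracle value
    greater than 1 stands for an undefined one, on which the machine gets stuck
    too.  A stuck machine repeats its state, so it never empties its stack. *)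
Definition step (q : nat -> nat) (s : nat) : nat :=
  let v := nfst s in
  let K := nsnd (nsnd s).-1 in
  let t := nfst (nfst (nsnd s).-1) in
  let p := nsnd (nfst (nsnd s).-1) in
  if nsnd s == 0 then s
  else if t == 0 then npair 0 K
  else if t == 1 then npair v.+1 K
  else if t == 2 then npair (nfst v) K
  else if t == 3 then npair (nsnd v) K
  else if t == 4 then if (q v <= 1)%N then npair (q v) K else s
  else if t == 5 then
    npair v (push (nfst p) (push (npair 9 (npair v (nsnd p))) K))
  else if t == 6 then npair v (push (nsnd p) (push (nfst p) K))
  else if t == 7 then
    npair (nfst v) (push (nfst p) (push
      (npair 11 (npair (nsnd p) (npair (nfst v) (npair 0 (nsnd v))))) K))
  else if t == 8 then
    npair (npair v 0) (push p (push (npair 12 (npair p (npair v 0))) K))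
  else if t == 9 then npair (nfst p) (push (nsnd p) (push (npair 10 v) K))
  else if t == 10 then npair (npair p v) K
  else if t == 11 then
    let g := nfst p in let a := nfst (nsnd p) in
    let m := nfst (nsnd (nsnd p)) in let n := nsnd (nsnd (nsnd p)) in
    if m == n then npair v K
    else npair (npair a (npair m v))
           (push g (push (npair 11 (npair g (npair a (npair m.+1 n)))) K))
  else if t == 12 then
    let f := nfst p in let x := nfst (nsnd p) in let m := nsnd (nsnd p) in
    if v == 0 then npair m K
    else npair (npair x m.+1)
           (push f (push (npair 12 (npair f (npair x m.+1))) K))
  else if t == 13 then
    if (nfst p <= 4)%N then if nsnd p == 0 then npair v K else s
    else if (nfst p <= 7)%N then
      npair v (push (npair 13 (nfst (nsnd p)))
                (push (npair 13 (nsnd (nsnd p))) K))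
    else if nfst p == 8 then npair v (push (npair 13 (nsnd p)) K)
    else s
  else s.

Lemma rec_step O (q : nat -> nat -> nat) s x :
  rec_in O (fun z => q (nfst z) (nsnd z)) -> rec_in O x -> rec_in O s ->
  rec_in O (fun z => step (q (x z)) (s z)).
Proof.
move=> rq rx rs; pose v z := q (x z) (nfst (s z)).
have rv : rec_in O v by apply: (rec_comp2 rq) => //; rec_auto.
rewrite /step /push; under eq_fun do rewrite -/(v _).
by rec_auto.
Qed.

Definition halts q n s := nsnd (iter n (step q) s) == 0.

Definition reaches q s t := exists n, iter n (step q) s = t.

Lemma reaches_trans q s t u : reaches q s t -> reaches q t u -> reaches q s u.
Proof. by move=> [n <-] [m <-]; exists (m + n); rewrite iterD. Qed.

Lemma reaches_step q s t : reaches q (step q s) t -> reaches q s t.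
Proof. by move=> [n <-]; exists n.+1; rewrite iterSr. Qed.

Lemma reaches_refl q s : reaches q s s.
Proof. by exists 0. Qed.

(** A run that empties a nonempty stack has a first step; the soundness proofs
    consume runs by this lemma. *)
Lemma halts_push q n v i K : halts q n (npair v (push i K)) ->
  exists2 n', n = n'.+1 & halts q n' (step q (npair v (push i K))).
Proof.
case: n => [|n]; first by rewrite /halts /= /push !npairE.
by rewrite /halts iterSr => h; exists n.
Qed.

(* Only the conditionals of [step] are simplified, so that [eval] is not
   unfolded. *)
Ltac stepE :=
  rewrite /step /push !npairE [if _ then _ else _]/=; rewrite ?npairE.

Lemma eval_prec0 A f g a r : eval A (cPrec f g) (npair a 0) r <-> eval A f a r.
Proof. by rewrite /= !npairE. Qed.

Lemma eval_precS A f g a n r : eval A (cPrec f g) (npair a n.+1) r <->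
  exists2 s, eval A (cPrec f g) (npair a n) s
           & eval A g (npair a (npair n s)) r.
Proof. by rewrite /= !npairE. Qed.

Section machine.
Variables (A : set nat) (q : nat -> nat).
Hypothesis qA : forall x, q x = (x \in A).

(** Completeness of the machine, by induction on the program: each continuation
    restores what the defining clause of [eval] needs. *)
Lemma eval_reaches c x y K : eval A c x y ->
  reaches q (npair x (push (godel c) K)) (npair y K).
Proof.
elim: c x y K => [|||||f IHf g IHg|f IHf g IHg|f IHf g IHg|f IHf] x y K;
  rewrite [godel _]/=.
- by move=> /= ->; exists 1; rewrite /=; stepE.
- by move=> /= ->; exists 1; rewrite /=; stepE.
- by move=> /= ->; exists 1; rewrite /=; stepE.
- by move=> /= ->; exists 1; rewrite /=; stepE.
- by move=> /= ->; exists 1; rewrite /=; stepE; rewrite qA leq_b1.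
- move=> [u [v [fu gv ->]]]; apply: reaches_step; stepE.
  apply: reaches_trans (IHf _ _ _ fu) _; apply: reaches_step; stepE.
  apply: reaches_trans (IHg _ _ _ gv) _; apply: reaches_step; stepE.
  exact: reaches_refl.
- move=> [u gu fy]; apply: reaches_step; stepE.
  by apply: reaches_trans (IHg _ _ _ gu) _; exact: IHf.
- rewrite -(npair_nfst_nsnd x); move: (nfst x) (nsnd x) => a N h.
  apply: reaches_step; stepE.
  have loop n r : (n <= N)%N -> eval A (cPrec f g) (npair a n) r ->
    reaches q
      (npair a (push (godel f)
        (push (npair 11 (npair (godel g) (npair a (npair 0 N)))) K)))
      (npair r (push (npair 11 (npair (godel g) (npair a (npair n N)))) K)).
    elim: n r => [|n IHn] r.
      by move=> _ /eval_prec0 fr; exact: IHf.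
    move=> nN /eval_precS[s ns gr]; apply: reaches_trans (IHn _ (ltnW nN) ns) _.
    apply: reaches_step; stepE; rewrite ltn_eqF //.
    exact: IHg.
  apply: reaches_trans (loop _ _ (leqnn N) h) _.
  by apply: reaches_step; stepE; rewrite eqxx; exact: reaches_refl.
- move=> [fy lty]; apply: reaches_step; stepE.
  have loop m : (m <= y)%N ->
    reaches q
      (npair (npair x 0) (push (godel f)
        (push (npair 12 (npair (godel f) (npair x 0))) K)))
      (npair (npair x m) (push (godel f)
        (push (npair 12 (npair (godel f) (npair x m))) K))).
    elim: m => [|m IHm] my; first exact: reaches_refl.
    apply: reaches_trans (IHm (ltnW my)) _.
    have [v fv] := lty _ my; apply: reaches_trans (IHf _ _ _ fv) _.
    by apply: reaches_step; stepE; exact: reaches_refl.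
  apply: reaches_trans (loop _ (leqnn y)) _.
  apply: reaches_trans (IHf _ _ _ fy) _.
  by apply: reaches_step; stepE; exact: reaches_refl.
Qed.

(** Soundness of the machine: a halting run started with a program on top of
    the stack first computes a value of the program.  The remaining run is
    strictly shorter, which is what the search for a minimum, having no bound
    known in advance, uses as its induction measure. *)
Lemma halts_eval c n x K : halts q n (npair x (push (godel c) K)) ->
  exists y, exists2 n', (n' < n)%N & eval A c x y /\ halts q n' (npair y K).
Proof.
elim: c n x K => [|||||f IHf g IHg|f IHf g IHg|f IHf g IHg|f IHf] n x K;
  rewrite [godel _]/= => /halts_push[{}n ->]; stepE.
- by exists 0, n.
- by exists x.+1, n.
- by exists (nfst x), n.
- by exists (nsnd x), n.
- by rewrite qA leq_b1; exists (x \in A), n.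
- move=> /IHf[u [n1 n1n [fu]]] /halts_push[m1 ?]; subst n1; stepE.
  move=> /IHg[v [n2 n2n [gv]]] /halts_push[m2 ?]; subst n2; stepE => h.
  exists (npair u v), m2; first lia.
  by split=> //; exists u, v.
- move=> /IHg[u [n1 n1n [gu]]] /IHf[y [n2 n2n [fy h]]].
  by exists y, n2; [lia | split=> //; exists u].
- rewrite -[in eval _ _ _](npair_nfst_nsnd x).
  move: (nfst x) (nsnd x) => a N.
  have loop k m n1 r : eval A (cPrec f g) (npair a m) r ->
      halts q n1 (npair r (push
        (npair 11 (npair (godel g) (npair a (npair m (m + k))))) K)) ->
      exists y, exists2 n', (n' < n1)%N &
        eval A (cPrec f g) (npair a (m + k)) y /\ halts q n' (npair y K).
    elim: k m n1 r => [|k IHk] m n1 r mr /halts_push[n2 ->]; stepE.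
      by rewrite addn0 eqxx => h; exists r, n2.
    rewrite ltn_eqF; last lia.
    move=> /IHg[y [n3 n3n [gy]]]; rewrite addnS -addSn => /IHk[|z [n4 n4n h]].
      by apply/eval_precS; exists r.
    by exists z, n4 => //; lia.
  move=> /IHf[r [n1 n1n [fr]]] /(loop N 0)[|y [n2 n2n h]].
    exact/eval_prec0.
  by exists y, n2 => //; lia.
- have loop n1 m :
      (forall i, (i < m)%N -> exists v, eval A f (npair x i) v.+1) ->
      halts q n1 (npair (npair x m) (push (godel f)
        (push (npair 12 (npair (godel f) (npair x m))) K))) ->
      exists y, exists2 n', (n' < n1)%N &
        eval A (cMu f) x y /\ halts q n' (npair y K).
    elim/ltn_ind: n1 m => n1 IHn m lem /IHf[v [n2 n2n [fv]]].
    move=> /halts_push[n3 ?]; subst n2; stepE.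
    case: v fv => [|v] /= fv h; first by exists m, n3; [lia | split].
    have [|i|y [n4 n4n h4]] := IHn n3 _ m.+1 _ h; first lia.
      by rewrite ltnS leq_eqVlt => /predU1P[->|/lem//]; exists v.
    by exists y, n4 => //; lia.
  by move=> /loop[//|y [n1 n1n h]]; exists y, n1 => //; lia.
Qed.

Lemma check_reaches c v K :
  reaches q (npair v (push (npair 13 (godel c)) K)) (npair v K).
Proof.
elim: c v K => [|||||f IHf g IHg|f IHf g IHg|f IHf g IHg|f IHf] v K /=;
  apply: reaches_step; stepE; try exact: reaches_refl; try exact: IHf;
  exact: reaches_trans (IHf _ _) (IHg _ _).
Qed.

(** The check filters the numbers that are not codes of programs; they must
    not count as elements of the jump. *)
Lemma halts_check e n v K : halts q n (npair v (push (npair 13 e) K)) ->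
  exists c, e = godel c /\ exists2 n', (n' < n)%N & halts q n' (npair v K).
Proof.
elim/ltn_ind: n e K => n IHn e K; rewrite -(npair_nfst_nsnd e).
move: (nfst e) (nsnd e) => t p /halts_push[m en].
have stuck : halts q m (npair v (push (npair 13 (npair t p)) K)) ->
    exists c, npair t p = godel c /\
      exists2 n', (n' < n)%N & halts q n' (npair v K).
  move=> /IHn[|c [-> [n' n'm h]]]; first by rewrite en.
  by exists c; split=> //; exists n' => //; rewrite en; lia.
stepE.
have chk f g : halts q m (npair v (push (npair 13 f) (push (npair 13 g) K))) ->
    exists cf cg, [/\ f = godel cf, g = godel cg &
      exists2 n', (n' < n)%N & halts q n' (npair v K)].
  move=> /IHn[|cf [-> [n1 n1m]]]; first by rewrite en.
  move=> /IHn[|cg [-> [n2 n2m h]]]; first by rewrite en; lia.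
  by exists cf, cg; split=> //; exists n2 => //; rewrite en; lia.
case: t stuck => [|[|[|[|[|[|[|[|[|t]]]]]]]]] //= stuck.
- case: eqP => [->|//] h; exists cZero; split=> //.
  by exists m => //; rewrite en.
- case: eqP => [->|//] h; exists cSucc; split=> //.
  by exists m => //; rewrite en.
- case: eqP => [->|//] h; exists cFst; split=> //.
  by exists m => //; rewrite en.
- case: eqP => [->|//] h; exists cSnd; split=> //.
  by exists m => //; rewrite en.
- case: eqP => [->|//] h; exists cOracle; split=> //.
  by exists m => //; rewrite en.
- move=> /chk[f [g [ef eg h]]]; exists (cPair f g); split=> //=.
  by rewrite -ef -eg npairE.
- move=> /chk[f [g [ef eg h]]]; exists (cComp f g); split=> //=.
  by rewrite -ef -eg npairE.
- move=> /chk[f [g [ef eg h]]]; exists (cPrec f g); split=> //=.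
  by rewrite -ef -eg npairE.
- move=> /IHn[|cf [-> [n1 n1m h]]]; first by rewrite en.
  by exists (cMu cf); split=> //; exists n1 => //; rewrite en; lia.
Qed.

(** The initial state tests that [e] is the code of a program and then runs this
    program on [e], as in the definition of the jump. *)
Definition start e := npair e (push (npair 13 e) (push e 0)).

Lemma jump_halts e : jump A e <-> exists n, halts q n (start e).
Proof.
rewrite /start.
split=> [[c [y cy] <-]|[n]].
  have [n h] := reaches_trans (check_reaches c (godel c) (push (godel c) 0))
    (eval_reaches 0 cy).
  by exists n; rewrite /halts h npairE.
move=> /halts_check[c [-> [n1 _ /halts_eval[y [n2 _ [cy _]]]]]].
by exists c => //; exists y.
Qed.

End machine.

(** * Halting with a finite part of the oracle *)

Lemma step_eq q q' s : q (nfst s) = q' (nfst s) -> step q s = step q' s.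
Proof. by rewrite /step => ->. Qed.

Lemma step_undefined q q' s : (1 < q (nfst s))%N ->
  step q s = s \/ step q s = step q' s.
Proof.
rewrite /step ltnNge => /negPf ->.
case: (nsnd s == 0); first by left.
case: (_ == 0); first by right.
case: (_ == 1); first by right.
case: (_ == 2); first by right.
case: (_ == 3); first by right.
by case: (_ == 4); [left | right].
Qed.

Lemma halts_final q n s : nsnd s = 0 -> halts q n s.
Proof.
move=> s0; rewrite /halts; suff -> : iter n (step q) s = s by rewrite s0.
by elim: n => //= n ->; rewrite /step s0.
Qed.

Lemma halts_leq q n n' s : (n <= n')%N -> halts q n s -> halts q n' s.
Proof.
by move=> /subnK <- /eqP h; rewrite /halts iterD; exact: halts_final.
Qed.

(** A halting run never got stuck on an undefined oracle value, so it is also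
    a run for every oracle with more defined values. *)
Lemma halts_sub q q' n s : (forall x, (q x <= 1)%N -> q' x = q x) ->
  halts q n s -> halts q' n s.
Proof.
move=> qq'; elim: n s => [//|n IHn] s.
rewrite {1}/halts iterSr -/(halts _ _ _) => h.
have [q1|q1] := leqP (q (nfst s)) 1.
  by rewrite /halts iterSr -/(halts _ _ _) (@step_eq _ q) ?qq'//; exact: IHn.
have [es|es] := step_undefined q' q1.
  by apply: (@halts_leq _ n) => //; apply: IHn; rewrite -es.
by rewrite /halts iterSr -/(halts _ _ _) -es; exact: IHn.
Qed.

(** The value 2 marks the arguments at which the oracle is undefined. *)
Definition truncated (p : nat -> bool) L x : nat :=
  if (x < L)%N then nat_of_bool (p x) else 2.

(** The use principle: a halting run asks finitely many questions. *)
Lemma halts_truncated (p : nat -> bool) n s : halts p n s ->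
  exists L0, forall L, (L0 <= L)%N -> halts (truncated p L) n s.
Proof.
elim: n s => [|n IHn] s; first by move=> h; exists 0.
rewrite {1}/halts iterSr -/(halts _ _ _) => /IHn[L0 hL0].
exists (maxn L0 (nfst s).+1) => L; rewrite geq_max => /andP[L0L sL].
rewrite /halts iterSr -/(halts _ _ _) (@step_eq _ p) ?hL0//.
by rewrite /truncated sL.
Qed.

(** One bound for the running time and for the oracle questions makes this
    monotone in [L] and decidable from the first [L] values of [p]. *)
Definition halts_within (p : nat -> bool) L e :=
  halts (truncated p L) L (start e).

Lemma halts_within_sub (p p' : nat -> bool) L L' e : (L <= L')%N ->
  (forall i, (i < L)%N -> p i = p' i) ->
  halts_within p L e -> halts_within p' L' e.
Proof.
move=> LL' pp' /(halts_leq LL'); apply: halts_sub => x.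
rewrite /truncated; case: ltnP => // xL _.
by rewrite (leq_trans xL LL') pp'.
Qed.

Lemma jump_halts_within A (p : nat -> bool) e : (forall x, p x = (x \in A)) ->
  jump A e <-> exists L, halts_within p L e.
Proof.
move=> pA; have {}pA x : p x = (x \in A) :> nat by rewrite pA.
split=> [/(jump_halts pA)[n hn]|[L hL]].
  have [L0 hL0] := halts_truncated hn; exists (maxn n L0).
  by apply: halts_leq (hL0 _ _); [exact: leq_maxl | exact: leq_maxr].
apply/(jump_halts pA); exists L; apply: halts_sub hL => x.
by rewrite /truncated; case: ltnP.
Qed.

(** Finite parts of oracles are represented by the binary digits of a number. *)
Definition bit m i := odd (iter i half m).

Lemma bitS m i : bit m i.+1 = bit m./2 i.
Proof. by rewrite /bit iterSr. Qed.

Lemma bit_small m i : (m < 2 ^ i)%N -> bit m i = false.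
Proof.
elim: i m => [|i IHi] m; first by rewrite expn0; case: m.
by rewrite bitS expnS => h; apply: IHi; lia.
Qed.

Lemma bit_lt m i : bit m i -> (i < m)%N.
Proof.
apply: contraTT; rewrite -leqNgt => mi; rewrite bit_small //.
by apply: leq_ltn_trans mi (ltn_expl _ _).
Qed.

Lemma bit_add_expn D e i : (D < 2 ^ e)%N ->
  bit (D + 2 ^ e) i = (i == e) || bit D i.
Proof.
elim: e D i => [|e IHe] D i.
  rewrite expn0 ltnS leqn0 => /eqP ->.
  by case: i => // i; rewrite bitS bit_small ?expn_gt0// bit_small ?expn_gt0.
rewrite expnS => De; case: i => [|i].
  by rewrite /bit /= oddD oddM addbF.
rewrite !bitS (_ : (D + 2 * 2 ^ e)./2 = D./2 + 2 ^ e)%N; last lia.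
by rewrite IHe //; lia.
Qed.

Lemma bits_exist n (p : nat -> bool) :
  exists2 m, (m < 2 ^ n)%N & forall i, (i < n)%N -> bit m i = p i.
Proof.
elim: n p => [|n IHn] p; first by exists 0.
have [m mn hm] := IHn (fun i => p i.+1).
exists (p 0%N + m.*2)%N.
  by rewrite expnS -mul2n; have := leq_b1 (p 0%N); lia.
case=> [|i] lin; first by rewrite /bit /= oddD odd_double oddb addbF.
by rewrite bitS half_bit_double hm.
Qed.

Lemma rec_halts_within O m L e : rec_in O m -> rec_in O L -> rec_in O e ->
  rec_in O (fun x => nat_of_bool (halts_within (bit (m x)) (L x) (e x))).
Proof.
move=> rm rL re; rewrite /halts_within /halts.
pose q c x : nat := truncated (bit (nfst c)) (nsnd c) x.
have rq : rec_in O (fun z => q (nfst z) (nsnd z)).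
  by rewrite /q /truncated /bit; rec_auto.
pose s c s := step (q c) s.
have rs : rec_in O (fun z => s (nfst z) (nsnd z)).
  by apply: (@rec_step _ q (fun z => nsnd z) (fun z => nfst z) rq); rec_auto.
pose i c e := iter (nsnd c) (s c) e.
have ri : rec_in O (fun z => i (nfst z) (nsnd z)).
  rewrite /i; rec_auto.
  by refine (@rec_comp2 _ s (fun w => nfst (nfst w)) (fun w => nsnd w) rs _ _);
    rec_auto.
have -> : (fun x => nat_of_bool
    (nsnd (iter (L x) (step (truncated (bit (m x)) (L x))) (start (e x)))
      == 0)) =
    fun x => nat_of_bool (nsnd (i (npair (m x) (L x)) (start (e x))) == 0).
  by apply/funext => x; rewrite /i /s /q !npairE.
rec_auto; apply: (rec_comp2 ri); rewrite /start /push; rec_auto.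
Qed.

(** * Reductions to the jump *)

Fixpoint cst_code d := if d is d'.+1 then cComp cSucc (cst_code d') else cZero.

Lemma eval_cst_code A d x : eval A (cst_code d) x d.
Proof. by elim: d => //= d IH; exists d. Qed.

Lemma rec_godel_cst_code O d : rec_in O d ->
  rec_in O (fun x => godel (cst_code (d x))).
Proof.
move=> rd.
have -> : (fun x => godel (cst_code (d x))) = fun x =>
    iter (d x) (fun r => npair 6 (npair (npair 1 0) r)) (npair 0 0).
  by apply/funext => x; elim: (d x) => //= n <-.
by rec_auto.
Qed.

(** The jump of every oracle computes every computably enumerable set: the
    function [g] is the s-m-n function of a program that searches for [L]; it
    composes this program with one for the constant [d], which discards the
    input. *)
Lemma ce_jump (P : nat -> nat -> bool) :
  rec_in set0 (fun z => nat_of_bool (P (nfst z) (nsnd z))) ->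
  exists g, (forall O, rec_in O g) /\
    forall A d, jump A (g d) <-> exists L, P d L.
Proof.
move=> rP.
have [c cP] : rec_in set0 (fun z => nat_of_bool (~~ P (nfst z) (nsnd z))).
  by rec_auto.
pose u := cMu (oracle_free c).
have uP A d : (exists y, eval A u d y) <-> exists L, P d L.
  have cA L : eval A (oracle_free c) (npair d L) (~~ P d L).
    by apply/eval_oracle_free; have := cP (npair d L); rewrite !npairE.
  split=> [[y [cy _]]|exP].
    exists y; have := eval_det (cA y) cy.
    by case: (P d y).
  exists (ex_minn exP); case: ex_minnP => y Py miny; split.
    by have := cA y; rewrite Py.
  move=> m my; exists 0; have := cA m.
  by case Pm : (P d m) => //; have := miny _ Pm; rewrite leqNgt my.
exists (fun d => godel (cComp u (cst_code d))); split=> [B|A d].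
  by rewrite /=; rec_auto; exact: (rec_godel_cst_code (rec_id B)).
apply: iff_trans (uP A d); split=> [[c0 [y +] /godel_inj e]|[y uy]].
  rewrite {c0}e => -[d0 dd0 uy].
  by rewrite (eval_det dd0 (eval_cst_code _ _ _)) in uy; exists y.
exists (cComp u (cst_code d)) => //.
by exists y; exists d => //; exact: eval_cst_code.
Qed.

Lemma jump0_le_jump A : turing_le (jump set0) (jump A).
Proof.
have [|g [rg gP]] := @ce_jump (fun e L => halts_within (bit 0) L e).
  exact: (rec_halts_within (rec_cst _ 0) (rec_nsnd (rec_id _))
    (rec_nfst (rec_id _))).
have e0 x : bit 0 x = (x \in set0).
  by rewrite in_set0 bit_small ?expn_gt0.
suff -> : jump set0 = [set x | g x \in jump A].
  have [c cg] := rec_oracle (rg (jump A)).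
  by exists c => x; have := cg x; rewrite [in X in _ -> X]mem_setE.
apply/funext => x; apply/propext; rewrite (jump_halts_within x e0) /= -(gP A).
by rewrite inE.
Qed.

(** * The low basis theorem *)

(** Compactness of Cantor space for a decreasing sequence of nonempty clopen
    conditions.  The greedy choice of bits keeps the prefix compatible with
    all conditions at once, since an obstruction to [true] at one level and an
    obstruction to [false] at another would both occur at their maximum. *)
Lemma konig (F : nat -> (nat -> bool) -> Prop) (N : nat -> nat) :
  (forall L L' p, (L <= L')%N -> F L' p -> F L p) ->
  (forall L p p', (forall i, (i < N L)%N -> p i = p' i) -> F L p -> F L p') ->
  (forall L, exists p, F L p) ->
  exists p, forall L, F L p.
Proof.
move=> mono use F0.
pose ext s := forall L, exists2 p, F L p & s = mkseq p (size s).
have ext_rcons s : ext s -> ext (rcons s true) \/ ext (rcons s false).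
  move=> es; apply: contrapT => /not_orP[].
  move=> /existsNP[L1 n1] /existsNP[L2 n2].
  have [p Fp sp] := es (maxn L1 L2).
  have e : rcons s (p (size s)) = mkseq p (size s).+1 by rewrite mkseqS -sp.
  case ep : (p (size s)) e => e; [apply: n1 | apply: n2]; exists p;
    rewrite ?size_rcons//.
    by apply: mono Fp; exact: leq_maxl.
  by apply: mono Fp; exact: leq_maxr.
pose next s := `[< ext (rcons s true) >].
pose S n := iter n (fun s => rcons s (next s)) [::].
have extS n : ext (S n).
  elim: n => [|n /ext_rcons h] /=.
    by move=> L; have [p Fp] := F0 L; exists p.
  by rewrite /next; case: asboolP h => // nt [/nt|].
pose p i := next (S i).
have Sp n : S n = mkseq p n.
  by elim: n => //= n IH; rewrite {1}IH mkseqS.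
exists p => L; have [p' Fp'] := extS (N L) L.
rewrite Sp size_mkseq => e; apply: use Fp' => i iN.
by have := congr1 (nth false ^~ i) e; rewrite !nth_mkseq.
Qed.

Section low_basis.
Variables (G : nat -> (nat -> bool) -> bool) (N : nat -> nat).
Hypothesis recG :
  rec_in set0 (fun z => nat_of_bool (G (nfst z) (bit (nsnd z)))).
Hypothesis recN : rec_in set0 N.
Hypothesis G_leq : forall L L' p, (L <= L')%N -> G L' p -> G L p.
Hypothesis G_use :
  forall L p p', (forall i, (i < N L)%N -> p i = p' i) -> G L p -> G L p'.
Hypothesis G_ex : forall L, exists p, G L p.

(* The condition [Q D L] reads the oracle below [N L] to evaluate [G], and
   below [L] to run programs. *)
Let N' L := (N L + L)%N.

(* The programs that are required to diverge are the binary digits of [D]. *)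
Let Q D L p :=
  G L p && bforall D (fun i => bit D i ==> ~~ halts_within p L i).

Let QP D L p : reflect
  (G L p /\ forall i, bit D i -> ~~ halts_within p L i) (Q D L p).
Proof.
apply: (iffP andP) => -[GLp h]; split=> //.
  by move=> i Di; exact: (implyP (bforallP _ _ h i (bit_lt Di))).
by apply/bforallP => i _; apply/implyP; exact: h.
Qed.

Let Q_sub D D' L L' p : (L <= L')%N -> (forall i, bit D i -> bit D' i) ->
  Q D' L' p -> Q D L p.
Proof.
move=> LL' DD' /QP[GLp h]; apply/QP; split; first exact: G_leq GLp.
by move=> i /DD'/h; apply: contra; exact: halts_within_sub.
Qed.

Let Q_use D L p p' : (forall i, (i < N' L)%N -> p i = p' i) ->
  Q D L p -> Q D L p'.
Proof.
move=> pp' /QP[GLp h]; apply/QP; split.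
  by apply: G_use GLp => i iL; apply: pp'; rewrite /N'; lia.
move=> i /h; apply: contra; apply: halts_within_sub => // j jL.
by rewrite pp' // /N'; lia.
Qed.

Let inconsistent D L := bforall (2 ^ N' L) (fun m => ~~ Q D L (bit m)).

Let inconsistentP D L : reflect (forall p, ~~ Q D L p) (inconsistent D L).
Proof.
apply: (iffP (bforallP _ _)) => [h p|h m _]; last exact: h.
have [m mN mp] := bits_exist (N' L) p.
by apply: contra (h _ mN); apply: Q_use => i /mp.
Qed.

Let rec_inconsistent :
  rec_in set0 (fun z => nat_of_bool (inconsistent (nfst z) (nsnd z))).
Proof.
have rN f : rec_in set0 f -> rec_in set0 (fun x => N (f x)).
  exact: rec_comp.
rewrite /inconsistent /N' /Q; rec_auto.
- refine (@rec_comp2 _ (fun L m => nat_of_bool (G L (bit m)))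
    (fun x => nsnd (nfst x)) (fun x => nsnd x) recG _ _); rec_auto.
- by rewrite /bit; rec_auto.
- refine (@rec_halts_within _ (fun x => nsnd (nfst x))
    (fun x => nsnd (nfst (nfst x))) (fun x => nsnd x) _ _ _); rec_auto.
- exact: (rN (fun z => nsnd z) (rec_nsnd (rec_id _))).
Qed.

(** The jump of the empty set decides whether a finite set [D] of divergence
    requirements is consistent with [G], since inconsistency is computably
    enumerable by compactness.  Hence it computes the sequence of sets [D e],
    where [e] enters whenever this keeps the set consistent.  Any [p] that meets
    all of them has a jump decided by the sequence: if [e] did not enter, then
    the requirements that did, all met by [p], force the program [e] to
    halt. *)
Theorem low_basis :
  exists p : nat -> bool, low [set x | p x] /\ forall L, G L p.
Proof.
have [g [rg gP]] := ce_jump rec_inconsistent.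
pose test d e := g (d + 2 ^ e)%N \in jump set0.
pose D e := nat_rect (fun=> nat) 0%N
  (fun e d => if test d e then d else d + 2 ^ e)%N e.
have testP d e : reflect (exists L, inconsistent (d + 2 ^ e) L) (test d e).
  apply: (iffP idP) => [|h]; first by rewrite inE => /gP.
  by rewrite /test inE; apply/gP.
have D_lt e : (D e < 2 ^ e)%N.
  elim: e => //= e IHe; rewrite expnS; case: ifP => _; lia.
have bitD e i : bit (D e.+1) i = bit (D e) i || (~~ test (D e) e && (i == e)).
  rewrite /=; case: ifP => _; first by rewrite orbF.
  by rewrite bit_add_expn // orbC.
have D_sub e e' i : (e <= e')%N -> bit (D e) i -> bit (D e') i.
  move=> /subnK <-; elim: (e' - e)%N => // k IH /IH h.
  by rewrite addSn bitD h.
have Q_ex e L : exists p, Q (D e) L p.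
  elim: e L => [|e IHe] L.
    have [p Gp] := G_ex L; exists p; apply/QP; split=> // i.
    by rewrite bit_small ?expn_gt0.
  (* If [e] enters, consistency is what the test says; if it does not, the set
     is unchanged. *)
  rewrite /=; case: testP => // /forallNP/(_ L) consistent.
  apply: contrapT => noQ; apply: consistent; apply/inconsistentP => p.
  by apply/negP => Qp; apply: noQ; exists p.
have [p pQ] : exists p, forall L, Q (D L) L p.
  apply: (@konig (fun L p => Q (D L) L p) N') => [L L' p LL'|L p p'|L].
  - by apply: Q_sub => // i; exact: D_sub.
  - exact: Q_use.
  - exact: Q_ex.
exists p; split; last by move=> L; have /QP[] := pQ L.
split; last exact: jump0_le_jump.
have jumpE e : jump [set x | p x] e <-> test (D e) e.
  rewrite (@jump_halts_within _ p) => [|x]; last first.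
    by apply/idP/idP; rewrite inE.
  split=> [[L hL]|/testP[L /inconsistentP/(_ p)/negP nQ]].
    apply: contraT => te; have /QP[_ /(_ e)] := pQ (maxn L e.+1).
    rewrite (@D_sub e.+1) ?leq_maxr // ?bitD ?te ?eqxx ?orbT // => /(_ isT).
    by rewrite (@halts_within_sub p p L) ?leq_maxl.
  exists L; apply: contrapT => /negP nh; apply: nQ; apply/QP.
  have /QP[Gp Dp] : Q (D e) L p.
    by apply: Q_sub (pQ (maxn L e)) => [|i]; [|apply: D_sub]; lia.
  by split=> // i; rewrite bit_add_expn // => /predU1P[->|/Dp].
have rtest d e : rec_in (jump set0) d -> rec_in (jump set0) e ->
    rec_in (jump set0) (fun x => nat_of_bool (test (d x) (e x))).
  move=> rd re; rewrite /test; apply: rec_oracle; apply: (rec_comp (rg _)).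
  by rec_auto.
have rD : rec_in (jump set0) D.
  apply: rec_nat_rect; rec_auto.
  by refine (rtest (fun z => nsnd (nsnd z)) (fun z => nfst (nsnd z)) _ _);
    rec_auto.
have [c ctest] := rtest _ _ rD (rec_id _).
exists c => e; have := ctest e; congr (eval _ _ _ (nat_of_bool _)).
by apply/idP/idP => [/jumpE|]; rewrite inE // => /jumpE.
Qed.

End low_basis.

(** * Pruned subtrees of a given height *)

(** The code of the string of length [l] with binary value [v], the first bit
    being the least significant: the prefix of length [j] of this string has
    the value [v %% 2 ^ j]. *)
Definition node l v := ((2 ^ l).-1 + v)%N.

Lemma nodeS l v : (node l v).+1 = (2 ^ l + v)%N.
Proof. by rewrite /node -addSn prednK ?expn_gt0. Qed.

Lemma modn_exp2 v j l : (j <= l)%N -> (v %% 2 ^ l) %% 2 ^ j = v %% 2 ^ j.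
Proof. by move=> jl; rewrite modn_dvdm // dvdn_exp2l. Qed.

Definition level_count (p : nat -> bool) l :=
  (\sum_(0 <= v < 2 ^ l) p (node l v))%N.

Section pruning.
Local Open Scope set_scope.
Local Open Scope nat_scope.
Variables (t : nat -> bool) (k a : nat).
Hypothesis t_tree : forall l j v, (v < 2 ^ l)%N -> (j <= l)%N ->
  t (node l v) -> t (node j (v %% 2 ^ j)).
Hypothesis t_count : forall l, ((a + 2) * 2 ^ l <= level_count t l * 2 ^ k)%N.

(** A string of this length has half of the measure 4^-l / 2^k that the strings
    kept above a node of length [l] must reach, so at least two are needed. *)
Definition split_level l := (l.*2 + k).+1.

Record pruned L (p : nat -> bool) : Prop := Pruned {
  pruned_sub : forall l v, (l <= L)%N -> (v < 2 ^ l)%N ->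
    p (node l v) -> t (node l v);
  pruned_tree : forall l j v, (l <= L)%N -> (j <= l)%N -> (v < 2 ^ l)%N ->
    p (node l v) -> p (node j (v %% 2 ^ j));
  pruned_split : forall l v, (split_level l <= L)%N -> (v < 2 ^ l)%N ->
    p (node l v) -> exists x y, x != y /\
      forall z, z \in [:: x; y] -> [/\ (z < 2 ^ split_level l)%N,
        z %% 2 ^ l = v & p (node (split_level l) z)];
  pruned_count : forall l, (l <= L)%N ->
    (a * 2 ^ l <= level_count p l * 2 ^ k)%N
}.

Section level.
Variable L : nat.
Implicit Type F : {set 'I_(2 ^ L)}.

Definition below F l x := [exists v in F, v %% 2 ^ l == x].

Lemma belowP F l x :
  reflect (exists2 v : 'I_(2 ^ L), v \in F & v %% 2 ^ l = x) (below F l x).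
Proof.
by apply: (iffP exists_inP) => -[v vF /eqP]; exists v => //; exact/eqP.
Qed.

Lemma card_fibre l x : (l <= L)%N ->
  (#|[set v : 'I_(2 ^ L) | v %% 2 ^ l == x]| <= 2 ^ (L - l))%N.
Proof.
move=> lL; have lt v : (v < 2 ^ L)%N -> (v %/ 2 ^ l < 2 ^ (L - l))%N.
  by move=> vL; rewrite ltn_divLR ?expn_gt0// -expnD subnK.
rewrite -[leqRHS]card_ord.
pose f (v : 'I_(2 ^ L)) := Ordinal (lt v (ltn_ord v)).
rewrite -(@card_in_imset _ _ f); first exact: max_card.
move=> u v; rewrite !inE => /eqP ux /eqP vx /(congr1 val) /= uv.
by apply: val_inj; rewrite /= (divn_eq u (2 ^ l)) (divn_eq v (2 ^ l)) uv ux vx.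
Qed.

(** The measure of the leaves kept plus the weights of the nodes given up,
    multiplied by 2^(2L + k) to stay among integers. *)
Definition weight F : nat :=
  #|F| * 2 ^ (L + k) +
  \sum_(l < L.+1) \sum_(x < 2 ^ l) ~~ below F l x * 4 ^ (L - l).

(** There are 2^l strings of length l, so their weights 4^-l sum up to less
    than 2. *)
Lemma sum_pow : (\sum_(l < L.+1) 2 ^ l * 4 ^ (L - l) <= 2 * 4 ^ L)%N.
Proof.
suff : (\sum_(l < L.+1) 2 ^ l * 4 ^ (L - l) + 2 ^ L = 2 * 4 ^ L)%N by lia.
elim: L => [|n IHn]; first by rewrite big_ord_recl big_ord0.
rewrite big_ord_recr /= subnn muln1.
have e (i : 'I_n.+1) : (2 ^ i * 4 ^ (n.+1 - i) = 4 * (2 ^ i * 4 ^ (n - i)))%N.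
  by rewrite subSn -1?ltnS // expnS mulnCA.
rewrite (eq_bigr _ (fun i _ => e i)).
rewrite -big_distrr /= !expnS. move: IHn; set S := (\sum_(_ < _) _)%N; lia.
Qed.

(** The prefixes of a set of leaves of maximal [weight] form a pruned tree: when
    all leaves above some node have the same prefix at its splitting level,
    they are too few, and deleting them would gain the weight of the node. *)
Lemma pruned_ex_level : exists p, pruned L p.
Proof.
pose TL := [set v : 'I_(2 ^ L) | t (node L v)].
have [F FT Fmax] : exists2 F : {set 'I_(2 ^ L)}, F \subset TL &
    forall F', F' \subset TL ->
    (weight F' <= weight F)%N.
  case: (@arg_maxnP _ finset.set0 (fun F => F \subset TL) weight).
    exact: finset.sub0set.
  by move=> F FT Fmax; exists F => // F' F'T; exact: Fmax.
pose p n := let l := trunc_log 2 n.+1 in below F l (n.+1 - 2 ^ l).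
have pE l x : (x < 2 ^ l)%N -> p (node l x) = below F l x.
  move=> xl; rewrite /p nodeS (@trunc_log_eq 2 l) ?addKn//.
  by rewrite leq_addr expnS; lia.
have Fcard : (a * 2 ^ L <= #|F| * 2 ^ k)%N.
  have tL : level_count t L = #|TL|.
    rewrite /level_count big_mkord -sum1_card [RHS]big_mkcond /=.
    by apply: eq_bigr => v _; rewrite inE; case: (t _).
  have := t_count L; rewrite tL => hT.
  have := Fmax _ (subxx TL); rewrite {1}/weight.
  move=> /(leq_trans (leq_addr _ _)) hF.
  have hs : (\sum_(l < L.+1) \sum_(x < 2 ^ l) ~~ below F l x * 4 ^ (L - l)
      <= 2 * 4 ^ L)%N.
    apply: leq_trans sum_pow; apply: leq_sum => l _.
    rewrite -[in leqRHS](card_ord (2 ^ l)) -sum_nat_const.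
    apply: leq_sum => x _.
    by case: (below _ _ _); rewrite ?mul1n.
  rewrite /weight in hF; rewrite -(leq_pmul2r (expn_gt0 2 L)).
  have e4 : (4 ^ L = 2 ^ L * 2 ^ L)%N by rewrite -expnMn.
  move: hT hF hs; rewrite expnD e4; move: (\sum_(l < _) _)%N => S.
  move=> /(leq_mul (leqnn (2 ^ L))).
  by move: (2 ^ k) (2 ^ L) #|TL| #|F| => y x u f; nia.
exists p; split.
- move=> l v lL vl; rewrite pE // => /belowP[u uF <-].
  apply: (t_tree (ltn_ord u) lL).
  by have := fintype.subsetP FT _ uF; rewrite inE.
- move=> l j v lL jl vl; rewrite !pE ?ltn_mod ?expn_gt0// => /belowP[u uF <-].
  by apply/belowP; exists u; rewrite // modn_exp2.
- move=> l v; set h := split_level l => hL vl; rewrite pE // => bv.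
  have lh : (l <= h)%N by rewrite /h /split_level; lia.
  have lL := leq_trans lh hL.
  pose Fv := [set u in F | u %% 2 ^ l == v].
  have [u0 u0F u0v] := belowP _ _ _ bv.
  have [/existsP[u /andP[]]|] :=
      boolP [exists u, (u \in Fv) && (u %% 2 ^ h != u0 %% 2 ^ h)].
    rewrite inE => /andP[uF /eqP uv] uu0.
    exists (u %% 2 ^ h), (u0 %% 2 ^ h); split=> // z.
    rewrite !inE => /orP[]/eqP ->; rewrite ltn_mod expn_gt0 modn_exp2 //;
      split=> //; rewrite pE ?ltn_mod ?expn_gt0//; apply/belowP;
      by [exists u | exists u0].
  move=> /existsPn single; exfalso.
  (* All leaves above [v] have the prefix of [u0] at level [h]. *)
  have Fv_small : (#|Fv| <= 2 ^ (L - h))%N.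
    apply: leq_trans (card_fibre (u0 %% 2 ^ h) hL).
    apply/subset_leq_card/fintype.subsetP => u uFv; rewrite inE.
    by have := single u; rewrite uFv /= negbK.
  have cF : (#|F| = #|Fv| + #|F :\: Fv|)%N.
    rewrite -(cardsID Fv F); congr (#|pred_of_set _| + _)%N.
    by apply/finset.setIidPr/fintype.subsetP => u; rewrite inE => /andP[].
  have := Fmax (F :\: Fv) (fintype.subset_trans (finset.subsetDl _ _) FT).
  (* Deleting them turns [v] into a node without extension and keeps the other
     such nodes. *)
  have sub l' x : below (F :\: Fv) l' x -> below F l' x.
    by move=> /belowP[u]; rewrite inE => /andP[_ uF] <-; apply/belowP; exists u.
  have nb : ~~ below (F :\: Fv) l v.
    apply/negP => /belowP[u]; rewrite !inE => /andP[+ uF] uv.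
    by rewrite uF uv eqxx.
  rewrite /weight cF (bigD1 (Ordinal (lL : l < L.+1)%N)) //=.
  rewrite (bigD1 (Ordinal vl)) //= nb.
  rewrite [in leqRHS](bigD1 (Ordinal (lL : l < L.+1)%N)) //=.
  rewrite [in leqRHS](bigD1 (Ordinal vl)) //= bv /= mul0n add0n mul1n.
  have le_mulb (b1 b2 : bool) w : (b2 -> b1) -> (~~ b1 * w <= ~~ b2 * w)%N.
    by case: b1 b2 => [] [] // /(_ isT).
  have le1 : (\sum_(x < 2 ^ l | x != Ordinal vl)
        ~~ below F l x * 4 ^ (L - l) <=
      \sum_(x < 2 ^ l | x != Ordinal vl)
        ~~ below (F :\: Fv) l x * 4 ^ (L - l))%N.
    by apply: leq_sum => x _; apply: le_mulb; exact: sub.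
  have le2 : (\sum_(i < L.+1 | i != Ordinal (lL : l < L.+1)%N)
        \sum_(x < 2 ^ i) ~~ below F i x * 4 ^ (L - i) <=
      \sum_(i < L.+1 | i != Ordinal (lL : l < L.+1)%N)
        \sum_(x < 2 ^ i) ~~ below (F :\: Fv) i x * 4 ^ (L - i))%N.
    by do 2!apply: leq_sum => ? _; apply: le_mulb; exact: sub.
  move: le1 le2.
  do 4! [move: (\sum_(i < _ | _) _)%N => ?].
  have big : (#|Fv| * 2 ^ (L + k) < 4 ^ (L - l))%N.
    apply: leq_ltn_trans (leq_mul Fv_small (leqnn _)) _.
    rewrite -expnD (_ : 4 = 2 ^ 2)%N // -expnM ltn_exp2l //.
    by move: hL; rewrite /h /split_level; lia.
  move: big; rewrite mulnDl; move: (_ * _) (_ * _) (4 ^ _) => x y z; lia.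
- move=> l lL; rewrite -(leq_pmul2r (expn_gt0 2 (L - l))).
  have -> : (a * 2 ^ l * 2 ^ (L - l) = a * 2 ^ L)%N.
    by rewrite -mulnA -expnD subnKC.
  apply: leq_trans Fcard _; rewrite mulnAC leq_mul2r; apply/orP; right.
  rewrite /level_count big_mkord.
  have lt (v : 'I_(2 ^ L)) : (v %% 2 ^ l < 2 ^ l)%N by rewrite ltn_mod expn_gt0.
  rewrite -sum1_card (partition_big (fun v => Ordinal (lt v)) xpredT) //=.
  rewrite big_distrl /=; apply: leq_sum => x _; rewrite sum1dep_card pE //.
  case: belowP => [_|nb].
    rewrite mul1n; apply: leq_trans (card_fibre x lL).
    apply/fintype.subset_leq_card/fintype.subsetP => v.
    by rewrite !inE => /andP[_ /eqP <-].
  rewrite leqn0 cards_eq0; apply/eqP/finset.setP => v; rewrite !inE.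
  by apply/negP => /andP[vF /eqP/(congr1 val) /= vx]; apply: nb; exists v.
Qed.

End level.
End pruning.

(** * Pruned trees form an effectively closed class *)

Section pruned_test.
Variables (t : nat -> bool) (k a : nat).
Hypothesis rec_t : rec_in set0 (fun n => nat_of_bool (t n)).

Definition pruned_test L (p : nat -> bool) : bool :=
  bforall L.+1 (fun l => bforall (2 ^ l) (fun v => p (node l v) ==>
    [&& t (node l v), bforall l.+1 (fun j => p (node j (v %% 2 ^ j)))
      & (split_level k l <= L) ==>
        bexists (2 ^ split_level k l) (fun x =>
          bexists (2 ^ split_level k l) (fun y =>
            [&& x != y, x %% 2 ^ l == v, y %% 2 ^ l == v,
              p (node (split_level k l) x) & p (node (split_level k l) y)]))]))
  && bforall L.+1 (fun l => (a * 2 ^ l <= level_count p l * 2 ^ k)%N).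

Lemma prunedP L p : reflect (pruned t k a L p) (pruned_test L p).
Proof.
have lsplit l : (l <= split_level k l)%N by rewrite /split_level; lia.
apply: (iffP andP) => [[/bforallP ht /bforallP hc]|[hs ht hb hc]]; split.
- move=> l v lL vl plv; have := bforallP _ _ (ht l lL) v vl.
  by rewrite plv => /andP[].
- move=> l j v lL jl vl plv; have := bforallP _ _ (ht l lL) v vl.
  by rewrite plv => /and3P[_ /bforallP h _]; exact: h.
- move=> l v hL vl plv.
  have := bforallP _ _ (ht l (leq_trans (lsplit l) hL)) v vl.
  rewrite plv hL => /and3P[_ _ /bexistsP[x xl /bexistsP[y yl]]].
  move=> /and5P[xy /eqP xv /eqP yv px py]; exists x, y; split=> // z.
  by rewrite !inE => /orP[]/eqP ->.
- by move=> l; exact: hc.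
- apply/bforallP => l lL; apply/bforallP => v vl; apply/implyP => plv.
  apply/and3P; split; first exact: hs.
    by apply/bforallP => j jl; exact: ht plv.
  apply/implyP => hL; have [x [y [xy h]]] := hb _ _ hL vl plv.
  have [xh xv px] := h x (mem_head _ _).
  have [yh yv py] : [/\ (y < 2 ^ split_level k l)%N, y %% 2 ^ l = v
    & p (node (split_level k l) y)] by apply: h; rewrite !inE eqxx orbT.
  apply/bexistsP; exists x => //; apply/bexistsP; exists y => //.
  by apply/and5P; split=> //; apply/eqP.
- by apply/bforallP => l; exact: hc.
Qed.

Lemma pruned_leq L L' p : (L <= L')%N ->
  pruned t k a L' p -> pruned t k a L p.
Proof.
move=> LL' [hs ht hb hc]; split.
- by move=> l v lL; apply: hs; exact: leq_trans LL'.
- by move=> l j v lL; apply: ht; exact: leq_trans LL'.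
- by move=> l v lL; apply: hb; exact: leq_trans LL'.
- by move=> l lL; apply: hc; exact: leq_trans LL'.
Qed.

Lemma node_lt l L v : (l <= L)%N -> (v < 2 ^ l)%N -> (node l v < 2 ^ L.+1)%N.
Proof.
move=> lL vl; rewrite nodeS expnS mul2n -addnn.
have : (2 ^ l <= 2 ^ L)%N by rewrite leq_exp2l.
by move: (2 ^ l)%N (2 ^ L)%N vl => x y; lia.
Qed.

Lemma pruned_use L p p' : (forall i, (i < 2 ^ L.+1)%N -> p i = p' i) ->
  pruned t k a L p -> pruned t k a L p'.
Proof.
move=> pp' [hs ht hb hc].
have {}pp' l v : (l <= L)%N -> (v < 2 ^ l)%N -> p' (node l v) = p (node l v).
  by move=> lL vl; rewrite pp' //; exact: node_lt.
split.
- by move=> l v lL vl; rewrite pp' //; exact: hs.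
- by move=> l j v lL jl vl; rewrite !pp' ?ltn_mod ?expn_gt0 //;
     [exact: ht | exact: leq_trans lL].
- move=> l v lL vl; rewrite pp' //; last by move: lL; rewrite /split_level; lia.
  move=> /(hb _ _ lL vl)[x [y [xy h]]]; exists x, y; split=> // z /h[zl zv pz].
  by split=> //; rewrite pp'.
- move=> l lL; suff -> : level_count p' l = level_count p l by exact: hc.
  by apply: eq_big_nat => v vl; rewrite pp'.
Qed.

Lemma rec_pruned_test :
  rec_in set0 (fun z => nat_of_bool (pruned_test (nfst z) (bit (nsnd z)))).
Proof.
have rt f : rec_in set0 f -> rec_in set0 (fun x => nat_of_bool (t (f x))).
  by move=> rf; exact: (rec_comp rec_t rf).
have rc m l : rec_in set0 m -> rec_in set0 l ->
    rec_in set0 (fun x => level_count (bit (m x)) (l x)).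
  move=> rm rl; rewrite /level_count.
  apply: (@rec_sum _ (fun x v => nat_of_bool (bit (m x) (node (l x) v)))).
    rewrite /bit /node; rec_auto.
      exact: (rec_comp rm (rec_nfst (rec_id _))).
    exact: (rec_comp rl (rec_nfst (rec_id _))).
  by rec_auto.
rewrite /pruned_test.
have -> : split_level k = fun l => (2 * l + k).+1.
  by apply/funext => l; rewrite mul2n.
rewrite /node /bit; rec_auto.
- by apply: rt; rec_auto.
- exact: (rc (fun z => nsnd (nfst z)) (fun z => nsnd z)
    (rec_nsnd (rec_nfst (rec_id _))) (rec_nsnd (rec_id _))).
Qed.

End pruned_test.

(** * Strings and numbers *)

Fixpoint string_value (s : seq bool) : nat :=
  if s is b :: s' then b + (string_value s').*2 else 0.

Lemma string_value_lt s : (string_value s < 2 ^ size s)%N.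
Proof. by elim: s => //= b s IH; rewrite expnS; case: b; lia. Qed.

Lemma string_code_node s : string_code s = node (size s) (string_value s).
Proof.
apply: succn_inj; rewrite nodeS; elim: s => //= b s IH.
by rewrite -addSn -addSn -doubleS IH expnS mul2n; lia.
Qed.

Lemma string_value_take j s : (j <= size s)%N ->
  string_value (take j s) = string_value s %% 2 ^ j.
Proof.
elim: s j => [|b s IH] [|j] //=; rewrite ?modn1 // ltnS => /IH ->.
rewrite -!muln2 !expnS; have p : (0 < 2 ^ j)%N by rewrite expn_gt0.
rewrite [in RHS](divn_eq (string_value s) (2 ^ j)).
have := ltn_pmod (string_value s) p.
move: (2 ^ j)%N p (string_value s %% 2 ^ j) (string_value s %/ 2 ^ j).
move=> y y0 r q ry.
rewrite (_ : b + (q * y + r) * 2 = q * (2 * y) + (b + 2 * r))%N; last lia.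
by rewrite modnMDl modn_small //; case: b; lia.
Qed.

Definition bits l v := mkseq (bit v) l.

Lemma string_value_bits l v : (v < 2 ^ l)%N -> string_value (bits l v) = v.
Proof.
elim: l v => [|l IH] v; first by rewrite expn0 ltnS leqn0 => /eqP ->.
rewrite expnS => vl; rewrite /bits /mkseq /= -[1%N]add1n iotaDl -map_comp.
rewrite (@eq_map _ _ _ (bit v./2)) => [|i]; last by rewrite /= add1n bitS.
by rewrite [string_value _]IH ?odd_double_half //; lia.
Qed.

Lemma string_code_bits l v : (v < 2 ^ l)%N -> string_code (bits l v) = node l v.
Proof. by move=> vl; rewrite string_code_node size_mkseq string_value_bits. Qed.

Lemma string_value_inj s s' : size s = size s' ->
  string_value s = string_value s' -> s = s'.
Proof.
by move=> es ev; apply: string_code_inj; rewrite !string_code_node es ev.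
Qed.

Lemma string_code_surj n : exists s, string_code s = n.
Proof.
elim/ltn_ind: n => -[|n] IH; first by exists [::].
have [|s es] := IH n./2; first lia.
by exists (odd n :: s); rewrite /= es addnC odd_double_half.
Qed.

Lemma take_mkseq (f : nat -> bool) j l : (j <= l)%N ->
  take j (mkseq f l) = mkseq f j.
Proof. by move=> jl; rewrite /mkseq -map_take take_iota (minn_idPl jl). Qed.

Lemma tree_take (S : set (seq bool)) j s : is_tree S -> S s -> S (take j s).
Proof. by move=> treeS; apply: treeS; exact: prefix_take. Qed.

Lemma is_tree_node (S : set (seq bool)) (p : nat -> bool) l j v :
  (forall s, p (string_code s) <-> S s) -> is_tree S ->
  (v < 2 ^ l)%N -> (j <= l)%N -> p (node l v) -> p (node j (v %% 2 ^ j)).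
Proof.
move=> pS treeS vl jl; rewrite -(string_code_bits vl).
move=> /pS/(tree_take j treeS)/pS; rewrite string_code_node.
rewrite string_value_take ?size_mkseq //.
by rewrite string_value_bits // size_takel ?size_mkseq.
Qed.

(** * Measure of the paths of a tree *)

Section measure.
Variable R : realType.
Local Open Scope ring_scope.
Local Notation mu := (uniform_measure R).

Definition level_paths (S : set (seq bool)) n : set cantor_borel :=
  [set X | S (mkseq X n)].

Lemma level_paths_bigcup (S : set (seq bool)) (p : nat -> bool) n :
  (forall s, p (string_code s) <-> S s) ->
  level_paths S n =
  \big[setU/set0]_(v < 2 ^ n | p (node n v)) cylinder (bits n v).
Proof.
move=> pS; rewrite -(bigcup_pred (fun v : 'I_(2 ^ n) => p (node n v))).
apply/seteqP; split=> [X SX|X [v /= pv]].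
  have vn := string_value_lt (mkseq X n); rewrite size_mkseq in vn.
  have e : bits n (string_value (mkseq X n)) = mkseq X n.
    by apply: string_value_inj; rewrite ?size_mkseq ?string_value_bits.
  exists (Ordinal vn); rewrite /= /cylinder /= /initial_segment.
    suff : p (node n (string_value (mkseq X n))) by [].
    by rewrite -(string_code_bits vn) e; apply/pS.
  by rewrite e size_mkseq.
rewrite /cylinder /= /initial_segment size_mkseq /level_paths /= => <-.
by apply/pS; rewrite string_code_bits.
Qed.

Lemma measurable_level_paths (S : set (seq bool)) n :
  measurable (level_paths S n).
Proof.
rewrite (@level_paths_bigcup _
  (fun i => `[< exists2 s, S s & string_code s = i >])).
  apply: bigsetU_measurable => v _; apply: sub_sigma_algebra.
  exact: open_cylinder.
move=> s; rewrite asboolE; split=> [[s' Ss' /string_code_inj <-]//|Ss].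
by exists s.
Qed.

Lemma measure_level_paths (S : set (seq bool)) (p : nat -> bool) n :
  (forall s, p (string_code s) <-> S s) ->
  mu (level_paths S n) = ((level_count p n)%:R / 2 ^+ n)%:E.
Proof.
move=> pS; rewrite (level_paths_bigcup n pS) measure_bigsetU_ord_cond /=.
- rewrite (eq_bigr (fun=> (2 ^- n)%:E)) => [|v _]; last first.
    by rewrite /= uniform_measure_cylinder size_mkseq.
  rewrite sumEFin /level_count big_mkord natr_sum big_mkcond /= mulr_suml.
  by congr EFin; apply: eq_bigr => v _; case: (p _); rewrite ?mul1r ?mul0r.
- by move=> v _; apply: sub_sigma_algebra; exact: open_cylinder.
- move=> u v _ _ [X []]; rewrite /cylinder /= /initial_segment !size_mkseq.
  move=> <- e; apply/val_inj.
  by rewrite /= -(string_value_bits (ltn_ord u)) -e string_value_bits.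
Qed.

Lemma measure_paths_le (S : set (seq bool)) (p : nat -> bool) n :
  (forall s, p (string_code s) <-> S s) ->
  (mu (paths S) <= ((level_count p n)%:R / 2 ^+ n)%:E)%E.
Proof.
move=> pS; rewrite -(measure_level_paths n pS); apply: le_measure.
- by rewrite inE; exact: measurable_paths.
- by rewrite inE; exact: measurable_level_paths.
- by move=> X; exact.
Qed.

(** The paths of a tree are the decreasing intersection of its levels. *)
Lemma measure_paths_ge (S : set (seq bool)) (p : nat -> bool) (c : R) :
  (forall s, p (string_code s) <-> S s) -> is_tree S ->
  (forall n, c <= (level_count p n)%:R / 2 ^+ n) ->
  (c%:E <= mu (paths S))%E.
Proof.
move=> pS treeS hc.
have pathsE : paths S = \bigcap_n level_paths S n.
  by apply/seteqP; split=> X SX n; [move=> _; exact: SX | exact: SX].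
have : (mu \o level_paths S) x @[x --> \oo] --> mu (paths S).
  rewrite pathsE; apply: nonincreasing_cvg_mu.
  - apply: le_lt_trans (ltry 1); apply: probability_le1.
    exact: measurable_level_paths.
  - by move=> n; exact: measurable_level_paths.
  - by rewrite -pathsE; exact: measurable_paths.
  - move=> n m nm; apply/subsetPset => X /(tree_take n treeS).
    by rewrite take_mkseq.
move=> cv; rewrite -(cvg_lim _ cv) //; apply: lime_ge.
  by apply/cvg_ex; eexists; exact: cv.
by apply: nearW => n; rewrite /= (measure_level_paths n pS) lee_fin.
Qed.

End measure.

(** * Trees with splitting are perfect *)

Section splitting.
Variables (S : set (seq bool)) (h : nat -> nat).
Hypothesis treeS : is_tree S.
Hypothesis S0 : S [::].
Hypothesis h_gt : forall l, (l < h l)%N.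
Hypothesis splits : forall s, S s -> exists s1 s2, [/\ s1 != s2,
  S s1 /\ S s2, size s1 = h (size s) /\ size s2 = h (size s) &
  take (size s) s1 = s /\ take (size s) s2 = s].

Lemma splitting_extends s n : S s ->
  exists s', [/\ S s', (n <= size s')%N & take (size s) s' = s].
Proof.
move=> Ss; elim: n => [|n [s' [Ss' ns' es']]].
  by exists s; rewrite take_size.
have [s1 [_ [_ [Ss1 _] [e1 _] [t1 _]]]] := splits Ss'.
exists s1; split=> //; first by rewrite e1 (leq_ltn_trans ns').
have ss' : (size s <= size s')%N by rewrite -es' size_take_min geq_minr.
by rewrite -[RHS]es' -[in RHS]t1 take_takel.
Qed.

(** Compactness, where the condition at level [L] also fixes the prefix [s] and
    therefore reads [maxn L (size s)] bits. *)
Lemma splitting_path s : S s -> exists2 X, paths S X & initial_segment s X.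
Proof.
move=> Ss.
have [|||X hX] := @konig (fun L X => S (mkseq X L) /\ s = mkseq X (size s))
    (fun L => maxn L (size s)).
- move=> L L' X LL' [SX sX]; split=> //.
  by rewrite -(take_mkseq X LL'); exact: tree_take.
- move=> L X Y XY [SX sX].
  have mk n : (n <= maxn L (size s))%N -> mkseq Y n = mkseq X n.
    move=> nL; apply: (@eq_from_nth _ false); rewrite ?size_mkseq // => i ni.
    by rewrite !nth_mkseq // XY // (leq_trans ni).
  by rewrite !mk ?leq_maxl ?leq_maxr.
- move=> L; have [s' [Ss' Ls' ts']] := splitting_extends L Ss.
  exists (nth false s').
  have ss' : (size s <= size s')%N by rewrite -ts' size_take_min geq_minr.
  have mk n : (n <= size s')%N -> mkseq (nth false s') n = take n s'.
    by move=> ns'; rewrite -{2}(mkseq_nth false s') take_mkseq.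
  by rewrite !mk // ts'; split=> //; exact: tree_take.
- exists X; last by have [] := hX 0%N.
  by move=> n; have [] := hX n.
Qed.

(** A path is a limit of other paths, since of two different extensions of one
    of its prefixes at the same level, at most one lies on it. *)
Lemma perfect_splitting : perfect_tree S.
Proof.
split; first by exists [::].
have closedC : closed (paths S).
  have -> : paths S = ~` (\bigcup_(s in ~` S) cylinder s).
    apply/seteqP; split=> [X SX [s nSs sX]|X nX n].
      by apply: nSs; rewrite sX; exact: SX.
    apply: contrapT => nSX; apply: nX; exists (mkseq X n) => //.
    by rewrite /cylinder /= /initial_segment size_mkseq.
  by apply: open_closedC; apply: bigcup_open => s _; exact: open_cylinder.
exists (paths S); split.
- by have [X SX _] := splitting_path S0; exists X.
- split=> //; apply/seteqP; split=> [X|X SX U].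
    by move=> /subset_limit_point; exact: closedC.
  move=> /nbhs_cylinder[n nU].
  have [s1 [s2 [s12 [Ss1 Ss2] [e1 e2] [t1 t2]]]] := splits (SX n).
  rewrite size_mkseq in e1 e2 t1 t2.
  have [s [Ss es ts sX]] : exists s, [/\ S s, size s = h n,
      take n s = mkseq X n & s != mkseq X (h n)].
    have [s1X|s1X] := eqVneq s1 (mkseq X (h n)); last by exists s1.
    by exists s2; split=> //; rewrite -s1X eq_sym.
  have [Y SY sY] := splitting_path Ss; exists Y; split=> //.
    apply: contraNneq sX => YX; rewrite sY es YX //.
  apply: nU; rewrite /cylinder /= /initial_segment size_mkseq -ts sY es.
  by rewrite take_mkseq // ltnW.
- apply/seteqP; split=> [s /splitting_path[X]|s [X SX ->]]; last exact: SX.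
  by exists X.
Qed.

End splitting.

Section pruned_tree.
Variables (t : nat -> bool) (k a : nat) (p : nat -> bool).
Hypothesis a_gt0 : (0 < a)%N.
Hypothesis p_pruned : forall L, pruned t k a L p.

Definition tree_of : set (seq bool) := [set s | p (string_code s)].

Lemma codes_tree_of : codes tree_of = [set n | p n].
Proof.
apply/seteqP; split=> [_ [s ps <-]//|n pn].
by have [s es] := string_code_surj n; exists s; rewrite // /tree_of /= es.
Qed.

Lemma is_tree_tree_of : is_tree tree_of.
Proof.
move=> s s' /prefixP[r es'] /=; rewrite es' => ps.
have ss' : (size s <= size (s ++ r))%N by rewrite size_cat leq_addr.
have := pruned_tree (p_pruned _) (leqnn _) ss' (string_value_lt _).
rewrite -string_code_node => /(_ ps).
by rewrite -string_value_take // take_size_cat // -string_code_node.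
Qed.

Lemma perfect_tree_of : perfect_tree tree_of.
Proof.
have split_gt l : (l < split_level k l)%N by rewrite /split_level; lia.
apply: (@perfect_splitting _ (split_level k)) => //.
- exact: is_tree_tree_of.
- have := pruned_count (p_pruned 0) (leqnn 0).
  rewrite /level_count expn0 big_nat1 /= (_ : node 0 0 = 0%N) // /tree_of /=.
  by case: (p 0%N) => //; rewrite mul0n muln1 leqNgt a_gt0.
move=> s; rewrite /tree_of /= string_code_node.
set h := split_level k (size s) => ps.
have [x [y [xy xyP]]] :=
  pruned_split (p_pruned _) (leqnn _) (string_value_lt s) ps.
have bitsP z : z \in [:: x; y] ->
    [/\ (z < 2 ^ h)%N, p (string_code (bits h z))
      & take (size s) (bits h z) = s].
  move=> /xyP[zl zs pz]; rewrite string_code_bits //; split=> //.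
  have sh : (size s <= h)%N by exact: ltnW.
  apply: string_value_inj; first by rewrite size_takel ?size_mkseq.
  by rewrite string_value_take ?size_mkseq // string_value_bits.
have [xl px tx] := bitsP x (mem_head _ _).
have [|yl py ty] := bitsP y; first by rewrite !inE eqxx orbT.
exists (bits h x), (bits h y); split=> //; last by rewrite !size_mkseq.
apply: contraNneq xy => /(congr1 string_value).
by rewrite !string_value_bits // => ->.
Qed.

End pruned_tree.

Local Open Scope ring_scope.

(** * Low perfect subtrees of large measure *)

(** The number [a] is two less than the integer part of [m * 2 ^ k], to make up
    for the weights of all strings. *)
Lemma dyadic_below (R : realType) (m eps : R) : 0 < m -> 0 < eps ->
  exists k, exists2 a, (0 < a)%N &
    (a + 2)%:R <= m * 2 ^+ k /\ m - eps < a%:R / 2 ^+ k.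
Proof.
move=> m0 eps0; have me0 : 0 < Num.min m eps by rewrite lt_min m0.
have [k hk] : exists k, 3 < Num.min m eps * 2 ^+ k.
  exists (Num.bound (3 / Num.min m eps)); rewrite mulrC -ltr_pdivrMr //.
  have := archi_boundP (divr_ge0 (ler0n R 3) (ltW me0)).
  move=> /lt_le_trans; apply; rewrite -natrX ler_nat.
  exact/ltnW/ltn_expl.
have hm : 3 < m * 2 ^+ k.
  by apply: lt_le_trans hk _; rewrite ler_pM2r ?exprn_gt0 // ge_min lexx.
have heps : 3 < eps * 2 ^+ k.
  by apply: lt_le_trans hk _; rewrite ler_pM2r ?exprn_gt0 // ge_min lexx orbT.
have /andP[] := truncn_itv (ltW (lt_trans (ltr0n R 3) hm)).
set N := Num.truncn _ => hN hN1.
have N3 : (2 < N)%N by rewrite -ltnS -(ltr_nat R); exact: lt_trans hN1.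
have eN : (N.+1%:R = (N - 2)%:R + 3 :> R).
  by rewrite -natrD; congr (_%:R); lia.
exists k, (N - 2)%N; first lia.
split; first by rewrite subnK 1?ltnW.
rewrite ltr_pdivlMr ?exprn_gt0 // mulrBl.
by move: hN1; rewrite eN; lra.
Qed.

Theorem proposition2p2 (R : realType) (T : set (seq bool)) (eps : R) :
  is_tree T ->
  computable (codes T) ->
  (0 < uniform_measure R (paths T))%E ->
  0 < eps ->
  exists P : set (seq bool),
    [/\ perfect_tree P,
        low (codes P),
        P `<=` T &
        (uniform_measure R (paths P) > uniform_measure R (paths T) - eps%:E)%E].
Proof.
move=> treeT compT muT eps0.
have mu_fin : uniform_measure R (paths T) \is a fin_num.
  by apply: fin_num_measure; exact: measurable_paths.
pose m := fine (uniform_measure R (paths T)).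
have mE : uniform_measure R (paths T) = m%:E by rewrite /m fineK.
have m0 : 0 < m by rewrite -lte_fin -mE.
have [k [a a0 [am ma]]] := dyadic_below m0 eps0.
pose t n := n \in codes T.
have tT s : t (string_code s) <-> T s.
  rewrite /t inE; split=> [[s' Ts' /string_code_inj <-]//|Ts].
  by exists s.
have t_tree l j v : (v < 2 ^ l)%N -> (j <= l)%N ->
    t (node l v) -> t (node j (v %% 2 ^ j)).
  exact: is_tree_node tT treeT.
have t_count l : ((a + 2) * 2 ^ l <= level_count t l * 2 ^ k)%N.
  rewrite -(ler_nat R) !natrM !natrX.
  have := measure_paths_le R l tT; rewrite mE lee_fin ler_pdivlMr ?exprn_gt0 //.
  move=> hl; apply: le_trans (_ : m * 2 ^+ k * 2 ^+ l <= _).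
    by rewrite ler_pM2r ?exprn_gt0.
  by rewrite mulrAC ler_pM2r ?exprn_gt0.
have rec_t : rec_in set0 (fun n => nat_of_bool (t n)) by [].
have [p [lowp hp]] : exists p : nat -> bool,
    low [set x | p x] /\ forall L, pruned_test t k a L p.
  apply: (low_basis (rec_pruned_test k a rec_t)
    (rec_expn 2 (rec_succ (rec_id _)))) => [L L' p LL'|L p p' pp'|L].
  - by move=> /prunedP/(pruned_leq LL')/prunedP.
  - by move=> /prunedP/(pruned_use pp')/prunedP.
  - by have [p /prunedP hp] := pruned_ex_level t_tree t_count L; exists p.
have {}hp L : pruned t k a L p by apply/prunedP.
have treeP := is_tree_tree_of hp.
exists (tree_of p); split.
- exact: perfect_tree_of a0 hp.
- by rewrite codes_tree_of.
- move=> s; rewrite /tree_of /= string_code_node => ps; apply/tT.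
  rewrite string_code_node.
  exact: (pruned_sub (hp _) (leqnn _) (string_value_lt _) ps).
- apply: (@lt_le_trans _ _ (a%:R / 2 ^+ k)%:E).
    by rewrite mE -EFinB lte_fin.
  apply: (@measure_paths_ge _ (tree_of p) p) => // n.
  rewrite ler_pdivrMr ?exprn_gt0 // mulrAC ler_pdivlMr ?exprn_gt0 //.
  rewrite -!natrX -!natrM ler_nat.
  by have := pruned_count (hp n) (leqnn n).
Qed.
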